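(* Let $H$ be a finite dimensional Hopf algebra over a field $k$ with antipode $S$, and let $\sigma:H\otimes H\to k$ be a normalized and convolution invertible lazy 2-cocycle. Let $\overline{\sigma}:D(H)\otimes D(H)\to k$ be the normalized and convolution invertible lazy 2-cocycle on the Drinfeld double given by $$\overline{\sigma}(p\otimes h,q\otimes l)=p(1)\,q(S^{-1}(h_3)h_1)\,\sigma(h_2,l)\qquad (p,q\in H^*,\ h,l\in H).$$ Consider the $H$-bicomodule algebra $H(\sigma)$ and the diagonal crossed product $H^*\bowtie H(\sigma)$. Then $H^*\bowtie H(\sigma)=D(H)(\overline{\sigma})$ as $D(H)$-bicomodule algebras (on the common underlying space $H^*\otimes H$). Moreover, $\overline{\sigma}$ is unique with this property: if $\tau$ is a normalized and convolution invertible lazy 2-cocycle on $D(H)$ with $H^*\bowtie H(\sigma)=D(H)(\tau)$ as $D(H)$-bicomodule algebras, then $\tau=\overline{\sigma}$.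
   Context: Sweedler notation $\Delta(h)=h_1\otimes h_2$. For a Hopf algebra $K$, a linear map $\sigma:K\otimes K\to k$ is a left 2-cocycle if $\sigma(a_1,b_1)\sigma(a_2b_2,c)=\sigma(b_1,c_1)\sigma(a,b_2c_2)$; normalized if $\sigma(1,h)=\sigma(h,1)=\varepsilon(h)$; lazy if $\sigma(h_1,h'_1)h_2h'_2=\sigma(h_2,h'_2)h_1h'_1$. For a normalized, convolution invertible lazy (left) 2-cocycle $\sigma$ on $K$, $K(\sigma)$ is the algebra with underlying space $K$, unit $1$ and product $h\cdot_\sigma h'=\sigma(h_1,h'_1)h_2h'_2=h_1h'_1\sigma(h_2,h'_2)$; it is a $K$-bicomodule algebra with both coactions given by $\Delta$. Drinfeld double: $D(H)=H^*\otimes H$ with coalgebra structure $H^{*cop}\otimes H$ and product $(p\otimes h)(q\otimes l)=p(h_1\rightharpoonup q\leftharpoonup S^{-1}(h_3))\otimes h_2l$, where $(h\rightharpoonup p)(l)=p(lh)$ and $(p\leftharpoonup h)(l)=p(hl)$. Diagonal crossed product: for an $H$-bicomodule algebra $A$ with right coaction $a\mapsto a_{<0>}\otimes a_{<1>}$ and left coaction $a\mapsto a_{[-1]}\otimes a_{[0]}$, put $a_{\{-1\}}\otimes a_{\{0\}}\otimes a_{\{1\}}=a_{<0>_{[-1]}}\otimes a_{<0>_{[0]}}\otimes a_{<1>}\in H\otimes A\otimes H$. Then $H^*\bowtie A$ is $H^*\otimes A$ as a space, with unit $\varepsilon\bowtie 1_A$ and product $(p\bowtie a)(q\bowtie b)=p(a_{\{-1\}}\rightharpoonup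 q\leftharpoonup S^{-1}(a_{\{1\}}))\bowtie a_{\{0\}}b$. It is a $D(H)$-bicomodule algebra with coactions $p\bowtie a\mapsto (p_2\bowtie a_{<0>})\otimes(p_1\otimes a_{<1>})$ and $p\bowtie a\mapsto (p_2\otimes a_{[-1]})\otimes(p_1\bowtie a_{[0]})$, where $p_1\otimes p_2$ is the comultiplication of $H^*$. *)

(* Defs.v *)
From HB Require Import structures.
From mathcomp Require Import all_boot all_order all_algebra all_field.

Set Implicit Arguments.
Unset Strict Implicit.
Unset Printing Implicit Defensive.

Import GRing.Theory VectorInternalTheory.
Local Open Scope ring_scope.

Reserved Notation "u ⊗ v" (at level 40, left associativity).
Reserved Notation "'\tsum_' ( x , y <- t ) F"
  (at level 41, F at level 41, x name, y name, t at level 200,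
   right associativity, format "'[' '\tsum_' ( x ,  y  <-  t ) '/  '  F ']'").

(* The tensor product of finite-dimensional spaces, in coordinates: t i j is
   the coefficient of (vbase i) ⊗ (vbase j). *)
Section Tensor.
Variable k : fieldType.

Definition tensor (U V : vectType k) : Type := 'M[k]_(dim U, dim V).

HB.instance Definition _ (U V : vectType k) :=
  Vector.copy (tensor U V) 'M[k]_(dim U, dim V).

Definition tens (U V : vectType k) (u : U) (v : V) : tensor U V :=
  (v2r u)^T *m v2r v.

Definition vbase (U : vectType k) (i : 'I_(dim U)) : U := r2v (delta_mx 0 i).

(* The image of t under the linear map U ⊗ V -> W induced by F, for bilinear F
   (see tsum_tens); \tsum_(x, y <- t) F x y renders Sweedler-style sums. *)
Definition tsum (U V W : vectType k) (t : tensor U V) (F : U -> V -> W) : W :=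
  \sum_i \sum_j t i j *: F (vbase i) (vbase j).

Definition tlift (U V W : vectType k) (F : U -> V -> W) : 'Hom(tensor U V, W) :=
  linfun (fun t => tsum t F).

End Tensor.

Notation "U ⊗ V" := (tensor U V) : type_scope.
Notation "u ⊗ v" := (tens u v) : ring_scope.
Notation "'\tsum_' ( x , y <- t ) F" := (tsum t (fun x y => F)) : ring_scope.

Lemma linfunE (k : fieldType) (U W : vectType k) (f : U -> W) :
  linear f -> linfun f =1 f.
Proof.
move=> linf u; pose lf := GRing.isLinear.Build k U W *:%R f linf.
by pose g : {linear U -> W} := HB.pack f lf; exact: (lfunE g).
Qed.

Section TensorTheory.
Variables (k : fieldType) (U V W : vectType k) (F : U -> V -> W).

Fact tsum_is_linear : linear (fun t => tsum t F).
Proof.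
move=> a s t; rewrite /tsum scaler_sumr -big_split; apply: eq_bigr => i _ /=.
rewrite scaler_sumr -big_split; apply: eq_bigr => j _ /=.
by rewrite !mxE scalerDl scalerA.
Qed.

Lemma tliftE t : tlift F t = tsum t F.
Proof. exact/linfunE/tsum_is_linear. Qed.

Hypotheses (linF : forall u, linear (F u)) (linF' : forall v, linear (F^~ v)).

Lemma vbaseE (X : vectType k) (x : X) : x = \sum_i v2r x 0 i *: vbase i.
Proof.
apply: v2r_inj; rewrite [LHS]row_sum_delta linear_sum; apply: eq_bigr => i _.
by rewrite linearZ /= r2vK.
Qed.

Lemma tsum_tens u v : \tsum_(x, y <- u ⊗ v) F x y = F u v.
Proof.
pose fl v := HB.pack_for {linear U -> W} (F^~ v)
  (GRing.isLinear.Build k U W *:%R (F^~ v) (linF' v)).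
pose fr u := HB.pack_for {linear V -> W} (F u)
  (GRing.isLinear.Build k V W *:%R (F u) (linF u)).
have fE u' v' : F u' v' = fl v' u' by [].
have gE u' v' : F u' v' = fr u' v' by [].
rewrite /tsum [RHS]fE {2}(vbaseE u) linear_sum; apply: eq_bigr => i _.
rewrite linearZZ -fE gE {2}(vbaseE v) linear_sum scaler_sumr.
apply: eq_bigr => j _.
by rewrite linearZZ -gE scalerA !mxE big_ord1 !mxE.
Qed.

End TensorTheory.

HB.mixin Record Falgebra_isHopf (k : fieldType) H of Falgebra k H := {
  comul : 'Hom(H, (H ⊗ H)%type);
  counit : 'Hom(H, k^o);
  antipode : 'Hom(H, H);
  comulA : forall h : H,
    \tsum_(x, h3 <- comul h) \tsum_(h1, h2 <- comul x) h1 ⊗ (h2 ⊗ h3) =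
    \tsum_(h1, x <- comul h) \tsum_(h2, h3 <- comul x) h1 ⊗ (h2 ⊗ h3);
  counitl : forall h : H, \tsum_(h1, h2 <- comul h) counit h1 *: h2 = h;
  counitr : forall h : H, \tsum_(h1, h2 <- comul h) counit h2 *: h1 = h;
  comul1 : comul 1 = 1 ⊗ 1;
  comulM : forall g h : H,
    comul (g * h) =
    \tsum_(g1, g2 <- comul g) \tsum_(h1, h2 <- comul h) (g1 * h1) ⊗ (g2 * h2);
  counit1 : counit 1 = 1;
  counitM : forall g h : H, counit (g * h) = counit g * counit h;
  antipodel : forall h : H,
    \tsum_(h1, h2 <- comul h) (antipode h1 * h2) = (counit h : k) *: 1;
  antipoder : forall h : H,
    \tsum_(h1, h2 <- comul h) (h1 * antipode h2) = (counit h : k) *: 1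
}.

#[short(type="hopfType")]
HB.structure Definition Hopf (k : fieldType) :=
  { H of Falgebra k H & Falgebra_isHopf k H }.

(* Structure maps of a bialgebra on K, without the axioms. *)
Record bialg (k : fieldType) (K : vectType k) := Bialg {
  bmul : 'Hom((K ⊗ K)%type, K);
  bone : K;
  bcomul : 'Hom(K, (K ⊗ K)%type);
  bcounit : 'Hom(K, k^o)
}.

Definition hopf_bialg (k : fieldType) (H : hopfType k) : bialg H := {|
  bmul := tlift (fun x y : H => x * y);
  bone := 1;
  bcomul := comul;
  bcounit := counit
|}.

(* Structure maps of a K-bicomodule algebra on A, without the axioms, which
   are in is_bicomod_alg; equality of such records is equality of products,
   units and both coactions. *)
Record bicomod_alg (k : fieldType) (K A : vectType k) := BicomodAlg {
  amul : 'Hom((A ⊗ A)%type, A);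
  aone : A;
  rcoact : 'Hom(A, (A ⊗ K)%type);
  lcoact : 'Hom(A, (K ⊗ A)%type)
}.

Section Bialgebra.
Variables (k : fieldType) (K : vectType k) (B : bialg K).
Local Notation "x ∙ y" := (bmul B (x ⊗ y)) (at level 40, left associativity).
Local Notation Δ := (bcomul B).
Local Notation ε := (bcounit B).
Implicit Types σ : 'Hom((K ⊗ K)%type, k^o).

Definition left_2cocycle σ := forall a b c : K,
  \tsum_(a1, a2 <- Δ a) \tsum_(b1, b2 <- Δ b)
     (σ (a1 ⊗ b1) * σ ((a2 ∙ b2) ⊗ c)) =
  \tsum_(b1, b2 <- Δ b) \tsum_(c1, c2 <- Δ c)
     (σ (b1 ⊗ c1) * σ (a ⊗ (b2 ∙ c2))).

Definition normalized σ := forall h : K,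
  σ (bone B ⊗ h) = ε h /\ σ (h ⊗ bone B) = ε h.

Definition conv σ σ' (a b : K) : k^o :=
  \tsum_(a1, a2 <- Δ a) \tsum_(b1, b2 <- Δ b) (σ (a1 ⊗ b1) * σ' (a2 ⊗ b2)).

Definition conv_invertible σ := exists σ', forall a b : K,
  conv σ σ' a b = ε a * ε b /\ conv σ' σ a b = ε a * ε b.

Definition lazy σ := forall g h : K,
  \tsum_(g1, g2 <- Δ g) \tsum_(h1, h2 <- Δ h) σ (g1 ⊗ h1) *: (g2 ∙ h2) =
  \tsum_(g1, g2 <- Δ g) \tsum_(h1, h2 <- Δ h) σ (g2 ⊗ h2) *: (g1 ∙ h1).

Definition lazy_2cocycle σ :=
  [/\ left_2cocycle σ, normalized σ, conv_invertible σ & lazy σ].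

(* K(σ) *)
Definition cocycle_twist σ : bicomod_alg K K := {|
  amul := tlift (fun g h : K =>
    \tsum_(g1, g2 <- Δ g) \tsum_(h1, h2 <- Δ h) σ (g1 ⊗ h1) *: (g2 ∙ h2));
  aone := bone B;
  rcoact := Δ;
  lcoact := Δ
|}.

Definition is_algebra (A : vectType k) (m : 'Hom((A ⊗ A)%type, A)) (e : A) :=
  [/\ forall a b c, m (a ⊗ m (b ⊗ c)) = m (m (a ⊗ b) ⊗ c),
      forall a, m (e ⊗ a) = a & forall a, m (a ⊗ e) = a].

Definition is_rcomod_alg (A : vectType k) (X : bicomod_alg K A) :=
  let m a b := amul X (a ⊗ b) in let ρ := rcoact X in
  [/\ forall a,
        \tsum_(x, a2 <- ρ a) \tsum_(a0, a1 <- ρ x) a0 ⊗ (a1 ⊗ a2) =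
        \tsum_(a0, x <- ρ a) \tsum_(a1, a2 <- Δ x) a0 ⊗ (a1 ⊗ a2),
      forall a, \tsum_(a0, a1 <- ρ a) ε a1 *: a0 = a,
      ρ (aone X) = aone X ⊗ bone B &
      forall a b, ρ (m a b) =
        \tsum_(a0, a1 <- ρ a) \tsum_(b0, b1 <- ρ b) (m a0 b0) ⊗ (a1 ∙ b1)].

Definition is_lcomod_alg (A : vectType k) (X : bicomod_alg K A) :=
  let m a b := amul X (a ⊗ b) in let λ := lcoact X in
  [/\ forall a,
        \tsum_(a2, x <- λ a) \tsum_(a1, a0 <- λ x) a2 ⊗ (a1 ⊗ a0) =
        \tsum_(x, a0 <- λ a) \tsum_(a2, a1 <- Δ x) a2 ⊗ (a1 ⊗ a0),
      forall a, \tsum_(a1, a0 <- λ a) ε a1 *: a0 = a,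
      λ (aone X) = bone B ⊗ aone X &
      forall a b, λ (m a b) =
        \tsum_(a1, a0 <- λ a) \tsum_(b1, b0 <- λ b) (a1 ∙ b1) ⊗ (m a0 b0)].

Definition is_bicomod_alg (A : vectType k) (X : bicomod_alg K A) :=
  let ρ := rcoact X in let λ := lcoact X in
  [/\ is_algebra (amul X) (aone X), is_rcomod_alg X, is_lcomod_alg X &
      forall a,
        \tsum_(x, c <- ρ a) \tsum_(b, a0 <- λ x) b ⊗ (a0 ⊗ c) =
        \tsum_(b, x <- λ a) \tsum_(a0, c <- ρ x) b ⊗ (a0 ⊗ c)].

End Bialgebra.

Section DrinfeldDouble.
Variables (k : fieldType) (H : hopfType k).

Definition dual : vectType k := 'Hom(H, k^o).
Implicit Types (p q : dual) (h l : H).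

Definition dual_mul p q : dual :=
  linfun (fun h => \tsum_(h1, h2 <- comul h) (p h1 * q h2) : k^o).

Definition dual_base (i : 'I_(dim H)) : dual :=
  linfun (fun h => v2r h 0 i : k^o).

(* p_1 ⊗ p_2 with p_1(h) p_2(l) = p(h l), see dual_comulE. *)
Definition dual_comul : 'Hom(dual, (dual ⊗ dual)%type) :=
  linfun (fun p => \sum_i \sum_j
    p (vbase i * vbase j) *: (dual_base i ⊗ dual_base j)).

(* h ⇀ q and q ↼ h *)
Definition dual_lact h q : dual := linfun (fun l => q (l * h)).
Definition dual_ract q h : dual := linfun (fun l => q (h * l)).

(* The antipode of a finite-dimensional Hopf algebra is bijective, so the
   generic linear (pseudo-)inverse is its inverse. *)
Definition antipodeV : 'End(H) := (antipode^-1)%VF.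

Lemma dual_mulE p q h :
  dual_mul p q h = \tsum_(h1, h2 <- comul h) (p h1 * q h2 : k^o).
Proof.
by apply: linfunE => a x y; rewrite linearP; exact: tsum_is_linear.
Qed.

Lemma dual_lactE h q l : dual_lact h q l = q (l * h).
Proof. by apply: linfunE => a x y; rewrite mulrDl -scalerAl linearP. Qed.

Lemma dual_ractE q h l : dual_ract q h l = q (h * l).
Proof. by apply: linfunE => a x y; rewrite mulrDr -scalerAr linearP. Qed.

Lemma dual_baseE i h : dual_base i h = v2r h 0 i.
Proof. by apply: linfunE => a x y; rewrite linearP !mxE. Qed.

Lemma dual_comulE p h l :
  \tsum_(p1, p2 <- dual_comul p) (p1 h * p2 l) = p (h * l).
Proof.
set F := fun p1 p2 : dual => _.
rewrite linfunE; last first.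
  move=> a q r; rewrite scaler_sumr -big_split; apply: eq_bigr => i _ /=.
  rewrite scaler_sumr -big_split; apply: eq_bigr => j _ /=.
  by rewrite !lfunE /= lfunE /= scalerDl scalerA.
rewrite -tliftE {1}(vbaseE h) mulr_suml !linear_sum; apply: eq_bigr => i _.
rewrite {1}(vbaseE l) mulr_sumr !linear_sum; apply: eq_bigr => j _.
rewrite [LHS]linearZZ [X in _ *: X]tliftE tsum_tens => [|p1 a q r|p2 a q r]; last 2 first.
- by rewrite /F !lfunE /= lfunE /= mulrDr scalerAr.
- by rewrite /F !lfunE /= lfunE /= mulrDl scalerAl.
rewrite -[in RHS]scalerAl -[in RHS]scalerAr [RHS]linearZZ.
rewrite [X in _ = _ *: X]linearZZ /F !dual_baseE.
by rewrite [RHS]scalerA; exact: (@mulrC k).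
Qed.

Section DiagonalCrossedProduct.
Variables (A : vectType k) (X : bicomod_alg H A).

Definition diag_crossed_mul : 'Hom(((dual ⊗ A) ⊗ (dual ⊗ A))%type, (dual ⊗ A)%type) :=
  tlift (fun x y =>
    \tsum_(p, a <- x) \tsum_(q, b <- y)
    \tsum_(a', ar <- rcoact X a) \tsum_(al, a0 <- lcoact X a')
      dual_mul p (dual_ract (dual_lact al q) (antipodeV ar))
        ⊗ amul X (a0 ⊗ b)).

(* H^* ⋈ A *)
Definition diag_crossed : bicomod_alg (dual ⊗ H)%type (dual ⊗ A)%type := {|
  amul := diag_crossed_mul;
  aone := (counit : dual) ⊗ aone X;
  rcoact := tlift (fun p a =>
    \tsum_(p1, p2 <- dual_comul p) \tsum_(a0, a1 <- rcoact X a)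
      (p2 ⊗ a0) ⊗ (p1 ⊗ a1));
  lcoact := tlift (fun p a =>
    \tsum_(p1, p2 <- dual_comul p) \tsum_(a1, a0 <- lcoact X a)
      (p2 ⊗ a1) ⊗ (p1 ⊗ a0))
|}.

End DiagonalCrossedProduct.

Definition drinfeld_double : bialg (dual ⊗ H)%type := {|
  bmul := tlift (fun x y =>
    \tsum_(p, h <- x) \tsum_(q, l <- y)
    \tsum_(h', h3 <- comul h) \tsum_(h1, h2 <- comul h')
      dual_mul p (dual_ract (dual_lact h1 q) (antipodeV h3)) ⊗ (h2 * l));
  bone := (counit : dual) ⊗ 1;
  bcomul := tlift (fun p h =>
    \tsum_(p1, p2 <- dual_comul p) \tsum_(h1, h2 <- comul h)
      (p2 ⊗ h1) ⊗ (p1 ⊗ h2));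
  bcounit := tlift (fun (p : dual) h => p 1 * counit h : k^o)
|}.

(* \overline{σ} *)
Definition double_cocycle (σ : 'Hom((H ⊗ H)%type, k^o)) :
    'Hom(((dual ⊗ H) ⊗ (dual ⊗ H))%type, k^o) :=
  tlift (fun x y : (dual ⊗ H)%type =>
    \tsum_(p, h <- x) \tsum_(q, l <- y)
    \tsum_(h', h3 <- comul h) \tsum_(h1, h2 <- comul h')
      (p 1 * q (antipodeV h3 * h1) * σ (h2 ⊗ l))).

End DrinfeldDouble.

(* Main.v *)
Require Import Defs.
From HB Require Import structures.
From mathcomp Require Import all_boot all_order all_algebra all_field.

Set Implicit Arguments.
Unset Strict Implicit.
Unset Printing Implicit Defensive.

Import GRing.Theory VectorInternalTheory.
Local Open Scope ring_scope.

(** Identify p ⊗ h in H^* ⊗ H with the map x |-> p(x) h from H to H ([ev]).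
For a product m on the space H, the product of the diagonal crossed product
with coefficients in (H, m) becomes
  (f ⋆_m g)(x) = m(a_2, g(S^-1(a_3) x_2 a_1)),  where a = f(x_1),
which is [star m f g], and the coproduct of D(H), which is also the common
underlying coaction, becomes (x, y) |-> Δ(f(y x)).  With the original product
of H as m this is the product of D(H).  In this form two facts about ⋆ are
short Sweedler computations:
- if m is associative and Δ(m(a, b)) equals both m(a_1, b_1) ⊗ a_2 b_2 and
  a_1 b_1 ⊗ m(a_2, b_2), then ⋆_m is associative ([star_assoc]);
- if Δ(r(a, b)) = m(a_1, b_1) ⊗ n(a_2, b_2), then likewise
  Δ(s ⋆_r t) = (s_1 ⋆_m t_1) ⊗ (s_2 ⋆_n t_2) in H^* ⊗ H ([crossed_comul]).
The product of H(σ) satisfies both coproduct formulas, the second by laziness.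
Taking the original product for n, then for m, the crossed product
H^* ⋈ H(σ) is an algebra whose product is colinear over D(H) on both sides.

The rest is formal.  Let K carry a coproduct, a multiplicative counit ε and a
product.  A unital associative product m on K, with the unit of K, that is
colinear on both sides is determined by s = ε ∘ m: applying ε to one
tensor factor of Δ(m(a, b)) gives
  m(a, b) = s(a_1, b_1) a_2 b_2 = a_1 b_1 s(a_2, b_2).
Hence s is lazy, its cocycle identity is ε applied to associativity, and m is
the product of K(s) ([bicolinear_mul]).  For K = D(H) and the crossed product
with H(σ), the functional ε ∘ m is the cocycle of the theorem
([double_cocycle_counit]).  Conversely the counit recovers τ from K(τ)
([counit_twist]), whence uniqueness.  The convolution inverse is the same
construction applied to the convolution inverse of σ ([conv_double]).

All this uses that S is bijective and that S^-1 reverses products and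
coproducts.  Bijectivity is the Larson-Sweedler theorem; it is obtained from a
nonzero integral on H, written explicitly as a trace ([shift_integral],
[integral_sum], [antipode_eq0]). *)

(** * Linearity of expressions in one variable *)

Section Linearity.
Variables (k : fieldType) (U V W X Y : vectType k).

Lemma lin_id : linear (fun x : U => x).
Proof. by []. Qed.

Lemma lin_hom (f : 'Hom(V, W)) (g : U -> V) :
  linear g -> linear (fun x => f (g x)).
Proof. by move=> lg a x y; rewrite lg linearP. Qed.

Lemma lin_tsum (T : U -> tensor X Y) (F : X -> Y -> W) :
  linear T -> linear (fun x => tsum (T x) F).
Proof. by move=> lT a x y; rewrite lT; apply: tsum_is_linear. Qed.

Lemma lin_tsumF (t : tensor X Y) (F : U -> X -> Y -> W) :
  (forall a b, linear (fun x => F x a b)) -> linear (fun x => tsum t (F x)).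
Proof.
move=> lF a x y; rewrite /tsum scaler_sumr -big_split; apply: eq_bigr => i _ /=.
rewrite scaler_sumr -big_split; apply: eq_bigr => j _ /=.
by rewrite lF scalerDr !scalerA mulrC.
Qed.

Lemma lin_sum (I : Type) (r : seq I) (P : pred I) (F : U -> I -> W) :
  (forall i, linear (fun x => F x i)) ->
  linear (fun x => \sum_(i <- r | P i) F x i).
Proof.
move=> lF a x y; rewrite scaler_sumr -big_split; apply: eq_bigr => i _ /=.
exact: lF.
Qed.

Lemma lin_scale (g : U -> k^o) (v : W) :
  linear g -> linear (fun x => (g x : k) *: v).
Proof. by move=> lg a x y; rewrite lg scalerDl -scalerA. Qed.

Lemma lin_scaler (c : k) (g : U -> W) :
  linear g -> linear (fun x => c *: g x).
Proof. by move=> lg a x y; rewrite lg scalerDr !scalerA mulrC. Qed.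

Lemma lin_smul (g : U -> k^o) (c : k) :
  linear g -> linear (fun x => (g x : k) * c : k^o).
Proof.
move=> lg a x y; rewrite lg.
by transitivity ((a * g x + g y : k) * c) => //; rewrite mulrDl -mulrA.
Qed.

Lemma lin_smulr (c : k) (g : U -> k^o) :
  linear g -> linear (fun x => c * (g x : k) : k^o).
Proof.
move=> lg a x y; rewrite lg.
by transitivity (c * (a * g x + g y : k)) => //; rewrite mulrDr mulrCA.
Qed.

Lemma lin_tens (g : U -> X) (v : Y) : linear g -> linear (fun x => g x ⊗ v).
Proof.
by move=> lg a x y; rewrite lg /tens !linearP /= mulmxDl -scalemxAl.
Qed.

Lemma lin_tensr (u : X) (g : U -> Y) : linear g -> linear (fun x => u ⊗ g x).
Proof.
by move=> lg a x y; rewrite lg /tens !linearP.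
Qed.

Lemma lin_mul (A : falgType k) (g : U -> A) (v : A) :
  linear g -> linear (fun x => g x * v).
Proof. by move=> lg a x y; rewrite lg mulrDl scalerAl. Qed.

Lemma lin_mulr (A : falgType k) (u : A) (g : U -> A) :
  linear g -> linear (fun x => u * g x).
Proof. by move=> lg a x y; rewrite lg mulrDr scalerAr. Qed.

Lemma lin_app (f : 'Hom(V, W)) : linear f.
Proof. exact: linearP. Qed.

Lemma lin_comp (f : V -> W) (g : U -> V) :
  linear f -> linear g -> linear (fun x => f (g x)).
Proof. by move=> lf lg a x y; rewrite lg lf. Qed.

Lemma lin_eval (g : U -> 'Hom(V, W)) v : linear g -> linear (fun x => g x v).
Proof.
by move=> lg a x y; rewrite lg add_lfunE scale_lfunE.
Qed.

End Linearity.

Definition bilin (k : fieldType) (U V W : vectType k) (F : U -> V -> W) :=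
  (forall u, linear (F u)) /\ (forall v, linear (F^~ v)).

Section Bilinear.
Variables (k : fieldType) (U V W X : vectType k) (F : U -> V -> W).
Hypothesis bF : bilin F.

Lemma bilinl (g : X -> U) v : linear g -> linear (fun x => F (g x) v).
Proof. exact: lin_comp (bF.2 v). Qed.

Lemma bilinr u (g : X -> V) : linear g -> linear (fun x => F u (g x)).
Proof. exact: lin_comp (bF.1 u). Qed.

End Bilinear.

(** Proves the linearity side conditions of the Sweedler calculus, by recursion
on the expression in which the variable occurs. *)
Ltac lin :=
  lazymatch goal with
  | |- forall _, _ => let x := fresh "x" in
     intro x; lazy beta; lin
  | |- _ /\ _ => split; lin
  | |- bilin _ => split; lin
  | |- _ => first
    [ exact: lin_id
    | assumption
    | apply: lin_tsum; lin
    | apply: lin_tsumF; lin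
    | apply: lin_sum; lin
    | apply: lin_scaler; lin
    | apply: lin_scale; lin
    | apply: lin_tens; lin | apply: lin_tensr; lin
    | apply: lin_mul; lin | apply: lin_mulr; lin
    | apply: lin_smul; lin | apply: lin_smulr; lin
    | apply: lin_hom; lin | apply: lin_eval; lin | exact: lin_app
    | (eapply bilinl; [eassumption | lin]) | (eapply bilinr; [eassumption | lin])
    | (eapply lin_comp; [eassumption | lin])
    | match goal with h : _ |- _ => solve [apply: h] end
    ]
  end.

(** * Sums over tensors *)

Section Sums.
Variables (k : fieldType) (U V W X : vectType k).
Implicit Types (t : tensor U V) (F G : U -> V -> W).

Lemma eq_tsum t F G : (forall a b, F a b = G a b) -> tsum t F = tsum t G.
Proof. by move=> eFG; do 2!apply: eq_bigr => ? _; rewrite eFG. Qed.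

Lemma linear_tsum (f : W -> X) t F :
  linear f -> f (tsum t F) = \tsum_(a, b <- t) f (F a b).
Proof.
move=> lf.
pose g : {linear W -> X} := HB.pack f (GRing.isLinear.Build k W X *:%R f lf).
rewrite -[f]/(g : W -> X) linear_sum; apply: eq_bigr => i _.
by rewrite linear_sum; apply: eq_bigr => j _; rewrite linearZ.
Qed.

(** [tsum] evaluates its summand on basis vectors only; so, when the first factor
is one of them, nothing has to be linear in it. *)
Lemma tsum_basisl i (v : V) F :
  (forall a, linear (F a)) -> tsum (vbase i ⊗ v) F = F (vbase i) v.
Proof.
move=> lF; rewrite /tsum (bigD1 i) //= [X in _ + X]big1 ?addr0; last first.
  move=> j ne_ji; apply: big1 => l _.
  by rewrite !mxE big_ord1 !mxE r2vK mxE (negPf ne_ji) mul0r scale0r.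
rewrite [in RHS](vbaseE v).
pose g : {linear V -> W} :=
  HB.pack (F (vbase i)) (GRing.isLinear.Build k V W *:%R _ (lF (vbase i))).
rewrite -[F (vbase i)]/(g : V -> W) linear_sum; apply: eq_bigr => j _.
by rewrite linearZ !mxE big_ord1 !mxE r2vK mxE !eqxx mul1r.
Qed.

Lemma tsum_id t : \tsum_(a, b <- t) a ⊗ b = t.
Proof.
rewrite [RHS]matrix_sum_delta; apply: eq_bigr => i _; apply: eq_bigr => j _.
by rewrite /tens !r2vK trmx_delta mul_delta_mx.
Qed.

End Sums.

Lemma scale_tsum (k : fieldType) (U V W : vectType k) (c : k) (t : tensor U V)
    (F : U -> V -> W) :
  c *: tsum t F = \tsum_(a, b <- t) c *: F a b.
Proof. by apply: (linear_tsum (f := fun w => c *: w)); lin. Qed.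

Lemma tsum_tsum (k : fieldType) (U V W X Y : vectType k) (t : tensor X Y)
    (T : X -> Y -> tensor U V) (F : U -> V -> W) :
  tsum (tsum t T) F = \tsum_(x, y <- t) tsum (T x y) F.
Proof. by apply: (linear_tsum (f := fun s => tsum s F)); lin. Qed.

Lemma exchange_tsum (k : fieldType) (U V W X Y : vectType k) (t : tensor U V)
    (s : tensor X Y) (F : U -> V -> X -> Y -> W) :
  \tsum_(a, b <- t) \tsum_(x, y <- s) F a b x y =
  \tsum_(x, y <- s) \tsum_(a, b <- t) F a b x y.
Proof.
rewrite /tsum; under eq_bigr => i _.
  under eq_bigr => j _.
    rewrite scaler_sumr; under eq_bigr => l _ do rewrite scaler_sumr.
    over.
  rewrite exchange_big /=; under eq_bigr => l _ do rewrite exchange_big /=.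
  over.
rewrite exchange_big /=; apply: eq_bigr => l _; rewrite exchange_big /=.
apply: eq_bigr => m _; rewrite scaler_sumr; apply: eq_bigr => i _.
rewrite scaler_sumr; apply: eq_bigr => j _.
by rewrite !scalerA mulrC.
Qed.

Lemma tsum_sum (k : fieldType) (U V W : vectType k) (t : tensor U V)
    (I : Type) (r : seq I) (P : pred I) (F : I -> U -> V -> W) :
  \tsum_(a, b <- t) \sum_(i <- r | P i) F i a b =
  \sum_(i <- r | P i) \tsum_(a, b <- t) F i a b.
Proof.
rewrite /tsum [RHS]exchange_big; apply: eq_bigr => i _ /=.
rewrite [RHS]exchange_big; apply: eq_bigr => j _ /=.
by rewrite scaler_sumr.
Qed.

Lemma tsum0 (k : fieldType) (U V W : vectType k) (t : tensor U V)
    (F : U -> V -> W) : (forall a b, F a b = 0) -> tsum t F = 0.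
Proof.
by move=> F0; rewrite /tsum big1 // => i _; rewrite big1 // => j _; rewrite F0 scaler0.
Qed.

Lemma linear_scale (k : fieldType) (U W : vectType k) (f : U -> W) c u :
  linear f -> f (c *: u) = c *: f u.
Proof.
move=> lf; pose g : {linear U -> W} :=
  HB.pack f (GRing.isLinear.Build k U W *:%R f lf).
by rewrite -[f]/(g : U -> W) linearZ.
Qed.

Lemma linear_bigsum (k : fieldType) (U W : vectType k) (f : U -> W)
    (I : Type) (r : seq I) (P : pred I) (F : I -> U) :
  linear f -> f (\sum_(i <- r | P i) F i) = \sum_(i <- r | P i) f (F i).
Proof.
move=> lf; pose g : {linear U -> W} :=
  HB.pack f (GRing.isLinear.Build k U W *:%R f lf).
by rewrite -[f]/(g : U -> W) linear_sum.
Qed.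

(** * Coassociativity and the Sweedler calculus *)

Section Coassociativity.
Variables (k : fieldType) (K : vectType k).

Lemma eq_tsum_basis (U V W : vectType k) (t : tensor U V) (F G : U -> V -> W) :
  (forall i j, F (vbase i) (vbase j) = G (vbase i) (vbase j)) ->
  tsum t F = tsum t G.
Proof. by move=> eFG; do 2!apply: eq_bigr => ? _; rewrite eFG. Qed.

Lemma tsum_basis (U V W : vectType k) (F : U -> V -> W) i j :
  tsum (vbase i ⊗ vbase j) F = F (vbase i) (vbase j).
Proof.
rewrite /tsum (bigD1 i) //= [X in _ + X]big1 ?addr0; last first.
  move=> l ne; apply: big1 => m _.
  by rewrite !mxE big_ord1 !mxE !r2vK !mxE (negPf ne) mul0r scale0r.
rewrite (bigD1 j) //= [X in _ + X]big1 ?addr0; last first.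
  move=> l ne.
  by rewrite !mxE big_ord1 !mxE !r2vK !mxE (negPf ne) andbF mulr0 scale0r.
by rewrite !mxE big_ord1 !mxE !r2vK !mxE !eqxx mul1r scale1r.
Qed.

Definition coassociative (D : 'Hom(K, (K ⊗ K)%type)) := forall h : K,
  \tsum_(x, c <- D h) \tsum_(a, b <- D x) a ⊗ (b ⊗ c) =
  \tsum_(a, x <- D h) \tsum_(b, c <- D x) a ⊗ (b ⊗ c).

(** The summand F is arbitrary: both sides evaluate it on triples of basis
vectors only, with the same coefficients by coassociativity. *)
Lemma coassoc_tsum (D : 'Hom(K, (K ⊗ K)%type)) (W : vectType k) :
  coassociative D -> forall (h : K) (F : K -> K -> K -> W),
  \tsum_(x, c <- D h) \tsum_(a, b <- D x) F a b c =
  \tsum_(a, x <- D h) \tsum_(b, c <- D x) F a b c.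
Proof.
move=> coA h F.
have F_basis i j l :
    \tsum_(a, s <- vbase i ⊗ (vbase j ⊗ vbase l)) \tsum_(b, c <- s) F a b c
    = F (vbase i) (vbase j) (vbase l).
  by rewrite tsum_basisl ?tsum_basis //; lin.
have /(congr1 (fun t => \tsum_(a, s <- t) \tsum_(b, c <- s) F a b c)) := coA h.
rewrite !tsum_tsum; congr (_ = _); apply: eq_tsum_basis => i j;
  by rewrite tsum_tsum; apply: eq_tsum_basis => l m; rewrite F_basis.
Qed.

End Coassociativity.

Notation "'\Δ_' ( x , y <- h ) F" := (\tsum_(x, y <- comul h) F)
  (at level 41, F at level 41, x name, y name, h at level 200,
   right associativity) : ring_scope.

Section Sweedler.
Variables (k : fieldType) (H : hopfType k) (W : vectType k).
Implicit Types (g h : H) (f : H -> W).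
Local Notation S := (@antipode k H).
Local Notation ε := (@counit k H).

Lemma coassoc h (F : H -> H -> H -> W) :
  \Δ_(x, c <- h) \Δ_(a, b <- x) F a b c = \Δ_(a, x <- h) \Δ_(b, c <- x) F a b c.
Proof. by apply: coassoc_tsum; apply: comulA. Qed.

Lemma counitl_tsum f h : linear f -> \Δ_(a, b <- h) ε a *: f b = f h.
Proof.
move=> lf; rewrite -[in RHS](counitl h) (linear_tsum _ _ lf).
by apply: eq_tsum => a b; rewrite linear_scale.
Qed.

Lemma counitr_tsum f h : linear f -> \Δ_(a, b <- h) ε b *: f a = f h.
Proof.
move=> lf; rewrite -[in RHS](counitr h) (linear_tsum _ _ lf).
by apply: eq_tsum => a b; rewrite linear_scale.
Qed.

Lemma comul1_tsum (F : H -> H -> W) :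
  bilin F -> \Δ_(a, b <- 1) F a b = F 1 1.
Proof. by case=> lF lF'; rewrite comul1 tsum_tens. Qed.

Lemma comulM_tsum g h (F : H -> H -> W) : bilin F ->
  \Δ_(x, y <- g * h) F x y =
  \Δ_(g1, g2 <- g) \Δ_(h1, h2 <- h) F (g1 * h1) (g2 * h2).
Proof.
case=> lF lF'; rewrite comulM tsum_tsum; apply: eq_tsum => g1 g2.
by rewrite tsum_tsum; apply: eq_tsum => h1 h2; rewrite tsum_tens.
Qed.

Lemma antipodel_tsum f h : linear f -> \Δ_(a, b <- h) f (S a * b) = ε h *: f 1.
Proof. by move=> lf; rewrite -(linear_tsum _ _ lf) antipodel linear_scale. Qed.

Lemma antipoder_tsum f h : linear f -> \Δ_(a, b <- h) f (a * S b) = ε h *: f 1.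
Proof. by move=> lf; rewrite -(linear_tsum _ _ lf) antipoder linear_scale. Qed.

(** Four legs of an iterated coproduct, regrouped so that the two middle ones can
be contracted. *)
Lemma coassoc_mid h (F : H -> H -> H -> H -> W) :
  \Δ_(x, y <- h) \Δ_(a, b <- x) \Δ_(c, d <- y) F a b c d =
  \Δ_(a, x <- h) \Δ_(y, d <- x) \Δ_(b, c <- y) F a b c d.
Proof.
rewrite coassoc; apply: eq_tsum => a x.
by rewrite -(coassoc _ (fun b c d => F a b c d)).
Qed.

Lemma coassoc2 g h (F : H -> H -> H -> H -> H -> H -> W) :
  \Δ_(x, g3 <- g) \Δ_(y, h3 <- h) \Δ_(g1, g2 <- x) \Δ_(h1, h2 <- y)
    F g1 g2 g3 h1 h2 h3 =
  \Δ_(g1, x <- g) \Δ_(h1, y <- h) \Δ_(g2, g3 <- x) \Δ_(h2, h3 <- y)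
    F g1 g2 g3 h1 h2 h3.
Proof.
under eq_tsum => x g3 do rewrite exchange_tsum.
under [RHS]eq_tsum => g1 x do rewrite exchange_tsum.
rewrite coassoc; apply: eq_tsum => g1 x; apply: eq_tsum => g2 g3.
by rewrite coassoc.
Qed.

End Sweedler.

(** * The antipode reverses products and coproducts *)

Section Antipode.
Variables (k : fieldType) (H : hopfType k).
Implicit Types (g h : H).
Local Notation S := (@antipode k H).
Local Notation ε := (@counit k H).

Lemma antipode1 : S 1 = 1.
Proof.
have := antipodel (1 : H); rewrite comul1_tsum ?counit1 ?scale1r ?mulr1 //.
by lin.
Qed.

(** Both sides arise from S(g_1 h_1) g_2 h_2 S(h_3) S(g_3), contracting either
S(g_1 h_1) g_2 h_2 or, from the inside, g_2 h_2 S(h_3) S(g_3). *)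
Lemma antipodeM g h : S (g * h) = S h * S g.
Proof.
transitivity (\Δ_(g1, g2 <- g) \Δ_(h1, h2 <- h) \Δ_(x, y <- g1 * h1)
                 S x * y * (S h2 * S g2)); last first.
  transitivity (\Δ_(g1, g2 <- g) ε g1 *: \Δ_(h1, h2 <- h) ε h1 *: (S h2 * S g2)).
    apply: eq_tsum => g1 g2; rewrite scale_tsum; apply: eq_tsum => h1 h2.
    rewrite (antipodel_tsum (f := fun z => z * (S h2 * S g2))); last by lin.
    by rewrite counitM mul1r scalerA.
  rewrite (counitl_tsum (f := fun z => \Δ_(h1, h2 <- h) ε h1 *: (S h2 * S z)));
    last by lin.
  by rewrite (counitl_tsum (f := fun z => S z * S g)); last by lin.
transitivity (\Δ_(g1, u <- g) \Δ_(h1, v <- h) \Δ_(g2, g3 <- u) \Δ_(h2, h3 <- v)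
  S (g1 * h1) * (g2 * (h2 * S h3) * S g3)).
  transitivity (\Δ_(g1, u <- g) \Δ_(h1, v <- h) ε v *: (ε u *: S (g1 * h1))).
    under eq_tsum => g1 u.
      rewrite (counitr_tsum (f := fun z => ε u *: S (g1 * z))); last by lin.
      over.
    by rewrite (counitr_tsum (f := fun z => S (z * h))); last by lin.
  apply: eq_tsum => g1 u; apply: eq_tsum => h1 v.
  under eq_tsum => g2 g3.
    rewrite (antipoder_tsum (f := fun z => S (g1 * h1) * (g2 * z * S g3)));
      last by lin.
    rewrite mulr1; over.
  rewrite -scale_tsum (antipoder_tsum (f := fun z => S (g1 * h1) * z));
    last by lin.
  by rewrite mulr1.
have E g1 u : \Δ_(h1, v <- h) \Δ_(g2, g3 <- u) \Δ_(h2, h3 <- v)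
    S (g1 * h1) * (g2 * (h2 * S h3) * S g3) =
  \Δ_(g2, g3 <- u) \Δ_(w, h3 <- h) \Δ_(h1, h2 <- w)
    S (g1 * h1) * (g2 * (h2 * S h3) * S g3).
  by rewrite exchange_tsum; apply: eq_tsum => g2 g3; rewrite -coassoc.
under eq_tsum => g1 u do rewrite E.
rewrite -coassoc; apply: eq_tsum => x g3; rewrite exchange_tsum.
apply: eq_tsum => y h3; rewrite comulM_tsum; last by lin.
apply: eq_tsum => g1 g2; apply: eq_tsum => h1 h2.
by rewrite !mulrA.
Qed.

Lemma counit_antipode h : ε (S h) = ε h.
Proof.
transitivity (\Δ_(a, b <- h) ε (S a * b)); last first.
  by rewrite antipodel_tsum; [rewrite counit1; exact: mulr1 | lin].
rewrite -(counitr_tsum (f := fun z => ε (S z))); last by lin.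
by apply: eq_tsum => a b; rewrite counitM mulrC.
Qed.

(** Both sides arise from S(h_1)_1 h_2 S(h_5) ⊗ S(h_1)_2 h_3 S(h_4), contracting
either the first two legs, as Δ(S(h_1) h_2), or the last four from the inside. *)
Lemma antipode_comul (W : vectType k) h (F : H -> H -> W) : bilin F ->
  \Δ_(x, y <- S h) F x y = \Δ_(a, b <- h) F (S b) (S a).
Proof.
move=> bF.
transitivity (\Δ_(a, r <- h) \Δ_(b, s <- r) \Δ_(x, y <- S a)
   \Δ_(b1, b2 <- b) \Δ_(c, d <- s) F (x * b1 * S d) (y * b2 * S c)).
  rewrite -(counitr_tsum (f := fun z => \Δ_(x, y <- S z) F x y)); last by lin.
  apply: eq_tsum => a r; rewrite scale_tsum.
  rewrite exchange_tsum; apply: eq_tsum => x y.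
  rewrite (coassoc_mid _ (fun b1 b2 c d => F (x * b1 * S d) (y * b2 * S c))).
  transitivity (\Δ_(b1, u <- r) \Δ_(v, d <- u) ε v *: F (x * b1 * S d) y).
    under eq_tsum => b1 u.
      rewrite (counitl_tsum (f := fun z => F (x * b1 * S z) y)); last by lin.
      rewrite -mulrA; over.
    by rewrite (antipoder_tsum (f := fun z => F (x * z) y)) ?mulr1; last by lin.
  apply: eq_tsum => b1 u; apply: eq_tsum => v d.
  under [RHS]eq_tsum => b2 c do rewrite -(mulrA y).
  rewrite (antipoder_tsum (f := fun z => F (x * b1 * S d) (y * z))) ?mulr1 //.
  by lin.
rewrite -coassoc.
transitivity (\Δ_(r, s <- h) ε r *: \Δ_(c, d <- s) F (S d) (S c)); last first.
  rewrite (counitl_tsum (f := fun z => \Δ_(c, d <- z) F (S d) (S c))) //.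
  by lin.
apply: eq_tsum => r s.
transitivity (\Δ_(a, b <- r) \Δ_(z, w <- S a * b) \Δ_(c, d <- s)
   F (z * S d) (w * S c)).
  apply: eq_tsum => a b; by rewrite comulM_tsum //; lin.
rewrite (antipodel_tsum (f := fun y => \Δ_(z, w <- y) \Δ_(c, d <- s)
   F (z * S d) (w * S c))); last by lin.
rewrite comul1_tsum; last by lin.
by congr (_ *: _); apply: eq_tsum => c d; rewrite !mul1r.
Qed.

End Antipode.

(** * Integrals and the bijectivity of the antipode *)

Section AntipodeBijective.
Variables (k : fieldType) (H : hopfType k).
Implicit Types (g h x y : H).
Local Notation S := (@antipode k H).
Local Notation ε := (@counit k H).

Lemma dual_base_sum (W : vectType k) (f : H -> W) x :
  linear f -> \sum_i (dual_base i x : k) *: f (vbase i) = f x.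
Proof.
move=> lf; pose g : {linear H -> W} :=
  HB.pack f (GRing.isLinear.Build k H W *:%R f lf).
rewrite [in RHS](vbaseE x) -[f]/(g : H -> W) linear_sum; apply: eq_bigr => i _.
by rewrite linearZ dual_baseE.
Qed.

(** The right coaction of H on H^*, q |-> q_0 ⊗ q_1, evaluated at x in the
first factor: q_0(x) q_1 = x_1 q(x_2). *)
Definition shift (q : H -> k^o) x : H := \Δ_(a, b <- x) (q b : k) *: a.

Lemma shift_lin (q : H -> k^o) : linear q -> linear (shift q).
Proof. by move=> lq; rewrite /shift; lin. Qed.

(** H^* is a Hopf module: with the action (q · h)(x) = q(x S(h)) and the coaction
[shift], this is the compatibility of the two. *)
Lemma shift_antipode (q : H -> k^o) x h : linear q ->
  \Δ_(a, b <- x) (q (b * S h) : k) *: a =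
  \Δ_(h1, h2 <- h) shift q (x * S h1) * h2.
Proof.
move=> lq.
transitivity (\Δ_(a, b <- x) \Δ_(w, h2 <- h) \Δ_(u, v <- w)
    (q (b * S u) : k) *: (a * (S v * h2) : H)).
  apply: eq_tsum => a b; rewrite coassoc.
  rewrite -(counitr_tsum (f := fun z => (q (b * S z) : k) *: a)); last by lin.
  apply: eq_tsum => u r.
  rewrite (antipodel_tsum (f := fun z => (q (b * S u) : k) *: (a * z))) ?mulr1 //.
  by lin.
rewrite exchange_tsum; apply: eq_tsum => w h2.
rewrite /shift comulM_tsum; last by lin.
rewrite (linear_tsum (f := fun z => z * h2)); last by lin.
apply: eq_tsum => a b; rewrite antipode_comul; last by lin.
rewrite (linear_tsum (f := fun z => z * h2)); last by lin.
by apply: eq_tsum => u v; rewrite -scalerAl mulrA.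
Qed.

(** Coassociativity of the coaction, q_0 ⊗ q_1 ⊗ q_2, tested on a trilinear map
whose first argument is presented in the dual basis. *)
Lemma shift_coassoc (W : vectType k) (p : H -> k^o)
    (G : 'I_(dim H) -> H -> H -> W) :
  linear p -> (forall i, bilin (G i)) ->
  \sum_i \Δ_(a, b <- shift p (vbase i)) G i a b =
  \sum_i \sum_j G j (shift (dual_base i) (vbase j)) (shift p (vbase i)).
Proof.
move=> lp bG; have lT := shift_lin lp.
rewrite [RHS]exchange_big; apply: eq_bigr => j _ /=; have bGj := bG j.
transitivity (\Δ_(a, b <- vbase j) \sum_i
    (dual_base i b : k) *: G j a (shift p (vbase i))).
  under [RHS]eq_tsum => a b.
    rewrite (dual_base_sum (f := fun z => G j a (shift p z))); last by lin.
    rewrite linear_tsum; last by lin.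
    over.
  rewrite -coassoc /shift.
  rewrite (linear_tsum (f := fun z => \Δ_(a, b <- z) G j a b)); last by lin.
  apply: eq_tsum => a b.
  rewrite (linear_scale _ _ (f := fun z => \Δ_(a, b <- z) G j a b)); last by lin.
  by rewrite scale_tsum; apply: eq_tsum => c d; rewrite linear_scale; last by lin.
rewrite tsum_sum; apply: eq_bigr => i _.
rewrite {2}/shift (linear_tsum (f := fun z => G j z (shift p (vbase i)))).
  by apply: eq_tsum => a b; rewrite (linear_scale _ _ (bGj.2 _)).
exact: bGj.2.
Qed.

(** The projection p_0 · S(p_1) of p to the coinvariants of the Hopf module H^*;
it is the trace of y |-> x S^2(y_1) p(y_2). *)
Definition integral (p : H -> k^o) x : k^o :=
  \sum_i dual_base i (x * S (S (shift p (vbase i)))).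

Lemma integral_lin (p : H -> k^o) : linear (integral p).
Proof. by rewrite /integral; lin. Qed.

(** Coinvariants of the coaction are the functionals λ with x_1 λ(x_2) = λ(x) 1,
and every projection p_0 · S(p_1) is coinvariant: its coaction is
p_0 · S(p_3) ⊗ p_1 S(p_2). *)
Lemma shift_integral (p : H -> k^o) x : linear p ->
  shift (integral p) x = (integral p x : k) *: 1.
Proof.
move=> lp; have lT := shift_lin lp.
have lTi i : linear (shift (dual_base i : dual H)).
  by apply: shift_lin; lin.
transitivity (\sum_i \Δ_(a, b <- shift p (vbase i))
    shift (dual_base i) (x * S (S b)) * S a).
  rewrite {1}/shift /integral.
  under eq_tsum => a b do rewrite scaler_suml.
  rewrite tsum_sum; apply: eq_bigr => i _; rewrite shift_antipode.
    by rewrite antipode_comul //; have := lTi i; lin.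
  by lin.
rewrite (shift_coassoc
  (G := fun i a b => shift (dual_base i) (x * S (S b)) * S a)) //; last first.
  by move=> i; have := lTi i; lin.
rewrite /integral scaler_suml; apply: eq_bigr => i _.
move: (x * _) => z.
transitivity (\Δ_(a, b <- z) a * S (shift (dual_base i) b)).
  under eq_tsum => a b.
    rewrite -(dual_base_sum (f := fun b => a * S (shift (dual_base i) b)));
      last by have := lTi i; lin.
    over.
  rewrite tsum_sum; apply: eq_bigr => j _.
  rewrite {1}/shift (linear_tsum (f := fun z => z * _)); last by lin.
  by apply: eq_tsum => a b; rewrite scalerAl.
transitivity (\Δ_(a, b <- z) \Δ_(c, d <- b)
    (dual_base i d : k) *: (a * S c : H)).
  apply: eq_tsum => a b; rewrite /shift.
  rewrite (linear_tsum (f := fun z => a * S z)); last by lin.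
  by apply: eq_tsum => c d; rewrite linearZ scalerAr.
rewrite -coassoc.
rewrite -(counitl_tsum (f := fun d => (dual_base i d : k) *: (1 : H))); last by lin.
apply: eq_tsum => u d.
rewrite (antipoder_tsum (f := fun z => (dual_base i d : k) *: z)) //.
by lin.
Qed.

(** The module is generated by its coinvariants: (p_0 · S(p_1)) · p_2 = p.  In
particular some integral is nonzero. *)
Lemma integral_sum (p : H -> k^o) x : linear p ->
  \sum_i integral (dual_base i) (x * S (shift p (vbase i))) = p x.
Proof.
move=> lp; have lT := shift_lin lp; rewrite /integral.
rewrite -(shift_coassoc
  (G := fun i a b => dual_base i (x * S b * S (S a)))) //; last by lin.
transitivity (\sum_i (dual_base i x : k) *: ε (shift p (vbase i))).
  apply: eq_bigr => i _.
  transitivity (\Δ_(a, b <- shift p (vbase i)) dual_base i (x * S (S a * b))).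
    by apply: eq_tsum => a b; rewrite antipodeM mulrA.
  rewrite (antipodel_tsum (f := fun z => dual_base i (x * S z))); last by lin.
  by rewrite antipode1 mulr1; exact: mulrC.
rewrite (dual_base_sum (f := fun z => ε (shift p z))); last by lin.
rewrite /shift linear_tsum; last by lin.
rewrite -(counitl_tsum (f := p)) //.
by apply: eq_tsum => a b; rewrite linearZ; exact: mulrC.
Qed.

(** For a nonzero integral λ, the element h can be read off from λ · h, which
depends on S(h) only. *)
Lemma antipode_eq0 h : S h = 0 -> h = 0.
Proof.
move=> Sh0.
(* The values of the integrals below add up to ε(1) = 1. *)
have /existsP[i nz] : [exists i, integral (dual_base i)
    (1 * S (shift ε (vbase i))) != 0].
  apply: contraNT (oner_neq0 k) => /existsPn /= e0.
  rewrite -(@counit1 k H) -(@integral_sum ε 1); last by lin.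
  by rewrite big1 // => i _; have := e0 i; rewrite negbK => /eqP.
move: nz; set lam := integral _; set y := 1 * _ => nz.
have llam : linear lam by apply: integral_lin.
have lam0 x : \Δ_(h1, h2 <- h) (lam (x * S h1) : k) *: h2 = 0.
  transitivity (\Δ_(h1, h2 <- h) shift lam (x * S h1) * h2).
    apply: eq_tsum => h1 h2; rewrite shift_integral; last by lin.
    by rewrite -scalerAl mul1r.
  rewrite -shift_antipode // Sh0.
  have /(linear_scale 0 0) : linear (fun z => \Δ_(a, b <- x) (lam (b * z) : k) *: a).
    by lin.
  by rewrite !scale0r.
(* With ε(h_1) 1 = S(h_1 S(h_2)), the element λ(y) h is the sum of the terms
   λ(y S^2(h_2) S(h_1)) h_3, which lam0 annihilates. *)
suff /eqP : (lam y : k) *: h = 0 by rewrite scaler_eq0 (negPf nz) => /eqP.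
transitivity (\Δ_(h1, r <- h) \Δ_(h2, h3 <- r)
    (lam (y * S (S h2) * S h1) : k) *: h3).
  rewrite -coassoc -(counitl_tsum (f := fun z => (lam y : k) *: z)); last by lin.
  apply: eq_tsum => u h3.
  transitivity (\Δ_(a, b <- u) (lam (y * S (a * S b)) : k) *: h3).
    rewrite (antipoder_tsum (f := fun z => (lam (y * S z) : k) *: h3)); last by lin.
    by rewrite antipode1 mulr1.
  by apply: eq_tsum => a b; rewrite antipodeM mulrA.
under eq_tsum => h1 r.
  rewrite -(dual_base_sum (f := fun z => \Δ_(h2, h3 <- z)
    (lam (y * S (S h2) * S h1) : k) *: h3)); last by lin.
  over.
rewrite tsum_sum big1 // => j _.
under eq_tsum => h1 r do rewrite scale_tsum.
rewrite exchange_tsum; apply: tsum0 => a b.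
set z := y * _.
transitivity ((dual_base j (\Δ_(h1, h2 <- h) (lam (z * S h1) : k) *: h2) : k)
    *: b); last by rewrite lam0 linear0 scale0r.
rewrite (linear_tsum (f := fun u => (dual_base j u : k) *: b));
  last by lin.
apply: eq_tsum => c d; rewrite scalerA; congr (_ *: _).
by rewrite linearZ; exact: mulrC.
Qed.

Local Notation V := (@antipodeV k H).

Lemma antipodeVK : cancel V S.
Proof.
move=> h; rewrite /antipodeV limg_lfunVK //.
suff -> : limg S = fullv by rewrite memvf.
apply/eqP; rewrite -(dimv_leqif_eq (subvf _)) limg_dim_eq //.
apply/eqP; rewrite -subv0; apply/subvP => x; rewrite memv_cap memv_ker memvf.
by move=> /eqP/antipode_eq0 ->; rewrite mem0v.
Qed.

Lemma antipodeKV : cancel S V.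
Proof.
move=> h; apply/eqP; rewrite -subr_eq0; apply/eqP/antipode_eq0.
by rewrite linearB /= antipodeVK subrr.
Qed.

Lemma antipodeV1 : V 1 = 1.
Proof. by apply: (can_inj antipodeKV); rewrite antipodeVK antipode1. Qed.

Lemma antipodeVM g h : V (g * h) = V h * V g.
Proof.
by apply: (can_inj antipodeKV); rewrite antipodeM !antipodeVK.
Qed.

Lemma counit_antipodeV h : ε (V h) = ε h.
Proof. by rewrite -counit_antipode antipodeVK. Qed.

Lemma antipodeV_comul (W : vectType k) h (F : H -> H -> W) : bilin F ->
  \Δ_(x, y <- V h) F x y = \Δ_(a, b <- h) F (V b) (V a).
Proof.
move=> bF; rewrite -{2}(antipodeVK h) antipode_comul; last by lin.
by apply: eq_tsum => a b; rewrite !antipodeKV.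
Qed.

(** The inverse of S is an antipode for the opposite coproduct: S^-1(h_2) h_1 and
h_2 S^-1(h_1) are both ε(h) 1. *)
Lemma antipodeVl_tsum (W : vectType k) (f : H -> W) h :
  linear f -> \Δ_(a, b <- h) f (V b * a) = ε h *: f 1.
Proof.
move=> lf; rewrite -antipodeV1.
rewrite -(antipodel_tsum (f := fun z => f (V z))); last by lin.
by apply: eq_tsum => a b; rewrite antipodeVM antipodeKV.
Qed.

Lemma antipodeVr_tsum (W : vectType k) (f : H -> W) h :
  linear f -> \Δ_(a, b <- h) f (b * V a) = ε h *: f 1.
Proof.
move=> lf; rewrite -antipodeV1.
rewrite -(antipoder_tsum (f := fun z => f (V z))); last by lin.
by apply: eq_tsum => a b; rewrite antipodeVM antipodeKV.
Qed.

End AntipodeBijective.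

(** * Bicolinear products are cocycle twists *)

Lemma hom_tens_ext (k : fieldType) (U V W : vectType k)
    (f g : 'Hom((U ⊗ V)%type, W)) :
  (forall u v, f (u ⊗ v) = g (u ⊗ v)) -> f = g.
Proof.
move=> efg; apply/lfunP => t; rewrite -(tsum_id t).
rewrite !linear_tsum; [|by lin|by lin].
by apply: eq_tsum => u v; apply: efg.
Qed.

Lemma tlift_tens (k : fieldType) (U V W : vectType k) (F : U -> V -> W) u v :
  bilin F -> tlift F (u ⊗ v) = F u v.
Proof. by case=> lF lF'; rewrite tliftE tsum_tens. Qed.

Section Bicolinear.
Variables (k : fieldType) (K : vectType k) (B : bialg K).
Local Notation "x ∙ y" := (bmul B (x ⊗ y)) (at level 40, left associativity).
Local Notation Δ := (bcomul B).
Local Notation ε := (bcounit B).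

(** The part of the bialgebra axioms that makes a bicolinear product a twist. *)
Record augmented : Prop := Augmented {
  aug_coassoc : coassociative Δ;
  aug_counitl : forall a, \tsum_(a1, a2 <- Δ a) ε a1 *: a2 = a;
  aug_counitr : forall a, \tsum_(a1, a2 <- Δ a) ε a2 *: a1 = a;
  aug_comul1 : Δ (bone B) = bone B ⊗ bone B;
  aug_counitM : forall a b, ε (a ∙ b) = ε a * ε b
}.

Definition rcolinear (m : 'Hom((K ⊗ K)%type, K)) := forall a b,
  Δ (m (a ⊗ b)) = \tsum_(a1, a2 <- Δ a) \tsum_(b1, b2 <- Δ b)
    m (a1 ⊗ b1) ⊗ (a2 ∙ b2).

Definition lcolinear (m : 'Hom((K ⊗ K)%type, K)) := forall a b,
  Δ (m (a ⊗ b)) = \tsum_(a1, a2 <- Δ a) \tsum_(b1, b2 <- Δ b)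
    (a1 ∙ b1) ⊗ m (a2 ⊗ b2).

Lemma twist_mulE (σ : 'Hom((K ⊗ K)%type, k^o)) a b :
  amul (cocycle_twist B σ) (a ⊗ b) =
  \tsum_(a1, a2 <- Δ a) \tsum_(b1, b2 <- Δ b) (σ (a1 ⊗ b1) : k) *: (a2 ∙ b2).
Proof. by rewrite tlift_tens //; lin. Qed.

Hypothesis augB : augmented.

(** Since the counit is multiplicative, it recovers a cocycle from the twisted
product. *)
Lemma counit_twist (σ : 'Hom((K ⊗ K)%type, k^o)) a b :
  ε (amul (cocycle_twist B σ) (a ⊗ b)) = σ (a ⊗ b).
Proof.
rewrite twist_mulE linear_tsum; last by lin.
rewrite -[in RHS](aug_counitr augB a).
rewrite (linear_tsum (f := fun x => σ (x ⊗ b))); last by lin.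
apply: eq_tsum => a1 a2; rewrite linear_tsum; last by lin.
rewrite -[in RHS](aug_counitr augB b).
rewrite (linear_tsum (f := fun x => σ (_ ⊗ x))); last by lin.
apply: eq_tsum => b1 b2.
rewrite linearZ /= (aug_counitM augB).
rewrite (linear_scale _ _ (f := fun x => σ (_ ⊗ x))); last by lin.
rewrite (linear_scale _ _ (f := fun x => σ (x ⊗ _))); last by lin.
by rewrite [RHS]scalerA [X in _ = X *: _]mulrC; exact: mulrC.
Qed.

Section Structure.
Variable m : 'Hom((K ⊗ K)%type, K).
Hypotheses (algm : is_algebra m (bone B)) (rcm : rcolinear m) (lcm : lcolinear m).
Variable σ : 'Hom((K ⊗ K)%type, k^o).
Hypothesis sE : forall a b, σ (a ⊗ b) = ε (m (a ⊗ b)).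

(** Apply ε ⊗ id to the colinearity formula for Δ(m(a, b)). *)
Lemma rcolinear_twistE a b : m (a ⊗ b) =
  \tsum_(a1, a2 <- Δ a) \tsum_(b1, b2 <- Δ b) (σ (a1 ⊗ b1) : k) *: (a2 ∙ b2).
Proof.
rewrite -(aug_counitl augB (m _)) rcm tsum_tsum; apply: eq_tsum => a1 a2.
rewrite tsum_tsum; apply: eq_tsum => b1 b2.
by rewrite tsum_tens ?sE; [|lin..].
Qed.

Lemma lcolinear_twistE a b : m (a ⊗ b) =
  \tsum_(a1, a2 <- Δ a) \tsum_(b1, b2 <- Δ b) (σ (a2 ⊗ b2) : k) *: (a1 ∙ b1).
Proof.
rewrite -(aug_counitr augB (m _)) lcm tsum_tsum; apply: eq_tsum => a1 a2.
rewrite tsum_tsum; apply: eq_tsum => b1 b2.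
by rewrite tsum_tens ?sE; [|lin..].
Qed.

(** Expanding the twisted product on either side of the associativity of m, under
the counit, gives the two sides of the cocycle identity. *)
Lemma bicolinear_cocycle : left_2cocycle B σ.
Proof.
move=> a b c; transitivity (σ (m (a ⊗ b) ⊗ c)).
  rewrite rcolinear_twistE (linear_tsum (f := fun x => σ (x ⊗ c))); last by lin.
  apply: eq_tsum => a1 a2.
  rewrite (linear_tsum (f := fun x => σ (x ⊗ c))); last by lin.
  apply: eq_tsum => b1 b2.
  by rewrite (linear_scale _ _ (f := fun x => σ (x ⊗ c))); last by lin.
transitivity (σ (a ⊗ m (b ⊗ c))); first by rewrite !sE; case: algm => ->.
rewrite rcolinear_twistE (linear_tsum (f := fun x => σ (a ⊗ x))); last by lin.
apply: eq_tsum => b1 b2.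
rewrite (linear_tsum (f := fun x => σ (a ⊗ x))); last by lin.
apply: eq_tsum => c1 c2.
by rewrite (linear_scale _ _ (f := fun x => σ (a ⊗ x))); last by lin.
Qed.

Lemma bicolinear_normalized : normalized B σ.
Proof. by move=> h; rewrite !sE; case: algm => _ -> ->. Qed.

(** Both sides are m(a, b), by right and by left colinearity. *)
Lemma bicolinear_lazy : lazy B σ.
Proof. by move=> a b; rewrite -rcolinear_twistE -lcolinear_twistE. Qed.

Lemma bicolinear_mul : amul (cocycle_twist B σ) = m.
Proof. by apply: hom_tens_ext => a b; rewrite twist_mulE -rcolinear_twistE. Qed.

Lemma bicolinear_bicomod_alg : is_bicomod_alg B (cocycle_twist B σ).
Proof.
case: augB => coA cl cr D1 _.
have -> : cocycle_twist B σ =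
    {| amul := m; aone := bone B; rcoact := Δ; lcoact := Δ |}.
  by rewrite -bicolinear_mul.
split; [by [] | by split | split | ]; rewrite /= //.
Qed.

End Structure.
End Bicolinear.

(** * The twist of a Hopf algebra by a lazy cocycle *)

Section TwistHopf.
Variables (k : fieldType) (H : hopfType k).
Local Notation B := (hopf_bialg H).

Lemma hopf_mulE (a b : H) : bmul B (a ⊗ b) = a * b.
Proof. by rewrite tlift_tens //; lin. Qed.

Lemma hopf_augmented : augmented B.
Proof.
split; [exact: comulA | exact: counitl | exact: counitr | exact: comul1 |].
by move=> a b; rewrite hopf_mulE; exact: counitM.
Qed.

Variable σ : 'Hom((H ⊗ H)%type, k^o).
Hypothesis lazy_σ : lazy_2cocycle B σ.
Local Notation m := (amul (cocycle_twist B σ)).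

Lemma hopf_twistE (a b : H) : m (a ⊗ b) =
  \Δ_(a1, a2 <- a) \Δ_(b1, b2 <- b) (σ (a1 ⊗ b1) : k) *: (a2 * b2).
Proof.
rewrite twist_mulE; apply: eq_tsum => a1 a2; apply: eq_tsum => b1 b2.
by rewrite hopf_mulE.
Qed.

Lemma hopf_lazy_twistE (a b : H) : m (a ⊗ b) =
  \Δ_(a1, a2 <- a) \Δ_(b1, b2 <- b) (σ (a2 ⊗ b2) : k) *: (a1 * b1).
Proof.
rewrite twist_mulE; case: lazy_σ => _ _ _ ->.
apply: eq_tsum => a1 a2; apply: eq_tsum => b1 b2.
by rewrite hopf_mulE.
Qed.

Lemma twist_rcolinear : rcolinear B m.
Proof.
move=> a b; rewrite hopf_twistE linear_tsum; last by lin.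
transitivity (\Δ_(a1, x <- a) \Δ_(b1, y <- b) \Δ_(a2, a3 <- x)
  \Δ_(b2, b3 <- y) (σ (a1 ⊗ b1) : k) *: ((a2 * b2) ⊗ (a3 * b3))).
  apply: eq_tsum => a1 x; rewrite linear_tsum; last by lin.
  apply: eq_tsum => b1 y; rewrite linearZ /= comulM scale_tsum.
  by apply: eq_tsum => a2 a3; rewrite scale_tsum.
rewrite -coassoc2; apply: eq_tsum => x a3; apply: eq_tsum => y b3.
rewrite hopf_mulE hopf_twistE.
rewrite (linear_tsum (f := fun z => z ⊗ _)); last by lin.
apply: eq_tsum => a1 a2; rewrite (linear_tsum (f := fun z => z ⊗ _)); last by lin.
apply: eq_tsum => b1 b2.
by rewrite (linear_scale _ _ (f := fun z => z ⊗ _)); last by lin.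
Qed.

(** By laziness the cocycle may stand on the last legs, which leaves the first
legs to the untwisted product. *)
Lemma twist_lcolinear : lcolinear B m.
Proof.
move=> a b; rewrite hopf_lazy_twistE linear_tsum; last by lin.
transitivity (\Δ_(x, a3 <- a) \Δ_(y, b3 <- b) \Δ_(a1, a2 <- x)
  \Δ_(b1, b2 <- y) (σ (a3 ⊗ b3) : k) *: ((a1 * b1) ⊗ (a2 * b2))).
  apply: eq_tsum => a1 x; rewrite linear_tsum; last by lin.
  apply: eq_tsum => b1 y; rewrite linearZ /= comulM scale_tsum.
  by apply: eq_tsum => a2 a3; rewrite scale_tsum.
rewrite coassoc2; apply: eq_tsum => a1 x; apply: eq_tsum => b1 y.
rewrite hopf_mulE hopf_lazy_twistE.
rewrite (linear_tsum (f := fun z => _ ⊗ z)); last by lin.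
apply: eq_tsum => a2 a3; rewrite (linear_tsum (f := fun z => _ ⊗ z)); last by lin.
apply: eq_tsum => b2 b3.
by rewrite (linear_scale _ _ (f := fun z => _ ⊗ z)); last by lin.
Qed.

(** The cocycle identity, in terms of the twisted product. *)
Lemma twist_cocycleE (a b c : H) : σ (m (a ⊗ b) ⊗ c) = σ (a ⊗ m (b ⊗ c)).
Proof.
case: lazy_σ => coc _ _ _.
transitivity (\Δ_(a1, a2 <- a) \Δ_(b1, b2 <- b)
  (σ (a1 ⊗ b1) * σ (bmul B (a2 ⊗ b2) ⊗ c) : k^o)).
  rewrite twist_mulE (linear_tsum (f := fun x => σ (x ⊗ c))); last by lin.
  apply: eq_tsum => a1 a2.
  rewrite (linear_tsum (f := fun x => σ (x ⊗ c))); last by lin.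
  apply: eq_tsum => b1 b2.
  by rewrite (linear_scale _ _ (f := fun x => σ (x ⊗ c))); last by lin.
rewrite coc twist_mulE (linear_tsum (f := fun x => σ (a ⊗ x))); last by lin.
apply: eq_tsum => b1 b2.
rewrite (linear_tsum (f := fun x => σ (a ⊗ x))); last by lin.
apply: eq_tsum => c1 c2.
by rewrite (linear_scale _ _ (f := fun x => σ (a ⊗ x))); last by lin.
Qed.

(** By right colinearity the two bracketings of a b c are
σ(m(a_1, b_1), c_1) a_2 b_2 c_2 and σ(a_1, m(b_1, c_1)) a_2 b_2 c_2. *)
Lemma twist_algebra : is_algebra m (1 : H).
Proof.
split=> [a b c | a | a].
- transitivity (\Δ_(x, a3 <- a) \Δ_(y, b3 <- b) \Δ_(c2, c3 <- c)
    (σ (m (x ⊗ y) ⊗ c2) : k) *: (a3 * b3 * c3)).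
    rewrite hopf_twistE; apply: eq_tsum => a1 a2.
    rewrite twist_rcolinear tsum_tsum; apply: eq_tsum => b1 b2.
    rewrite tsum_tsum; apply: eq_tsum => c1 c2.
    by rewrite tsum_tens ?hopf_mulE ?mulrA ?twist_cocycleE //; lin.
  rewrite hopf_twistE twist_rcolinear tsum_tsum; apply: eq_tsum => a1 a2.
  rewrite tsum_tsum; apply: eq_tsum => b1 b2.
  by rewrite tsum_tens ?hopf_mulE //; lin.
- rewrite hopf_twistE comul1_tsum; last by lin.
  case: lazy_σ => _ nrm _ _.
  rewrite -[RHS](counitl a); apply: eq_tsum => a1 a2.
  by rewrite (nrm a1).1 mul1r.
- rewrite hopf_twistE -[RHS](counitl a); apply: eq_tsum => a1 a2.
  case: lazy_σ => _ nrm _ _.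
  by rewrite comul1_tsum ?(nrm a1).2 ?mulr1 //; lin.
Qed.

End TwistHopf.

(** * The crossed product on maps from H to H *)

Section CrossedConvolution.
Variables (k : fieldType) (H : hopfType k) (W : vectType k).
Local Notation V := (@antipodeV k H).
Local Notation ε := (@counit k H).

Lemma coassoc_midl (a : H) (F : H -> H -> H -> H -> W) :
  \Δ_(x, y <- a) \Δ_(a1, a2 <- x) \Δ_(a3, a4 <- y) F a1 a2 a3 a4 =
  \Δ_(x, a4 <- a) \Δ_(a1, y <- x) \Δ_(a2, a3 <- y) F a1 a2 a3 a4.
Proof.
under eq_tsum => x y do rewrite exchange_tsum.
by rewrite -coassoc; apply: eq_tsum => x a4; rewrite -coassoc.
Qed.

Lemma coassoc5 (a : H) (F : H -> H -> H -> H -> H -> W) :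
  \Δ_(x, y <- a) \Δ_(z, a3 <- x) \Δ_(a4, a5 <- y) \Δ_(a1, a2 <- z)
    F a1 a2 a3 a4 a5 =
  \Δ_(x, a5 <- a) \Δ_(a1, y <- x) \Δ_(z, a4 <- y) \Δ_(a2, a3 <- z)
    F a1 a2 a3 a4 a5.
Proof.
under eq_tsum => x y do rewrite exchange_tsum.
rewrite -coassoc; apply: eq_tsum => v a5; rewrite -coassoc.
by apply: eq_tsum => x a4; rewrite coassoc.
Qed.

(** The legs 3 and 4 of a six-fold coproduct cancel when they meet as
a_4 S^-1(a_3). *)
Lemma antipodeV_contract (a : H) (F : H -> H -> H -> H -> H -> W) :
  (forall a1 a2 a5 a6, linear (fun z => F a1 a2 z a5 a6)) ->
  \Δ_(c, d <- a) \Δ_(x, c3 <- c) \Δ_(c1, c2 <- x)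
    \Δ_(y, d3 <- d) \Δ_(d1, d2 <- y) F c1 c2 (d1 * V c3) d2 d3 =
  \Δ_(x, a3 <- a) \Δ_(a1, y <- x) \Δ_(p, q <- y) F a1 p 1 q a3.
Proof.
move=> lF.
transitivity (\Δ_(c, d <- a) \Δ_(x, c3 <- c) \Δ_(d1, y <- d)
   \Δ_(c1, c2 <- x) \Δ_(d2, d3 <- y) F c1 c2 (d1 * V c3) d2 d3).
  apply: eq_tsum => c d; apply: eq_tsum => x c3.
  rewrite [RHS]exchange_tsum; apply: eq_tsum => c1 c2.
  by rewrite coassoc.
rewrite (coassoc_mid _ (fun x c3 d1 y =>
   \Δ_(c1, c2 <- x) \Δ_(d2, d3 <- y) F c1 c2 (d1 * V c3) d2 d3)).
rewrite -coassoc_midl; apply: eq_tsum => x u.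
transitivity (\Δ_(w, y <- u) ε w *:
   \Δ_(c1, c2 <- x) \Δ_(d2, d3 <- y) F c1 c2 1 d2 d3).
  apply: eq_tsum => w y.
  rewrite (antipodeVr_tsum (f := fun z => \Δ_(c1, c2 <- x) \Δ_(d2, d3 <- y)
    F c1 c2 z d2 d3)) //; lin.
rewrite (counitl_tsum (f := fun y => \Δ_(c1, c2 <- x) \Δ_(d2, d3 <- y)
    F c1 c2 1 d2 d3)) //; lin.
Qed.

End CrossedConvolution.

Section Star.
Variables (k : fieldType) (H : hopfType k).
Implicit Types (f g h : H -> H) (m n r : 'Hom((H ⊗ H)%type, H)).
Local Notation V := (@antipodeV k H).
Local Notation B := (hopf_bialg H).

(** The diagonal crossed product on maps f, g : H -> H; see [ev_crossed]. *)
Definition star m f g z : H := \Δ_(z1, z2 <- z) \Δ_(a', a3 <- f z1)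
  \Δ_(a1, a2 <- a') m (a2 ⊗ g (V a3 * z2 * a1)).

(** One use of each colinearity leaves the original product on both outer legs. *)
Lemma bicolinear_comul2 (W : vectType k) m (F : H -> H -> H -> W) a b :
  rcolinear B m -> lcolinear B m ->
  (forall x, bilin (F x)) -> (forall y z, linear (fun x => F x y z)) ->
  \Δ_(x, c3 <- m (a ⊗ b)) \Δ_(c1, c2 <- x) F c1 c2 c3 =
  \Δ_(x, a3 <- a) \Δ_(a1, a2 <- x) \Δ_(y, b3 <- b) \Δ_(b1, b2 <- y)
    F (a1 * b1) (m (a2 ⊗ b2)) (a3 * b3).
Proof.
move=> rcm lcm bF lF; rewrite rcm tsum_tsum; apply: eq_tsum => x a3.
rewrite tsum_tsum [RHS]exchange_tsum; apply: eq_tsum => y b3.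
have bFz z : bilin (fun x y => F x y z).
  by split=> ?; [apply: (bF _).2 | apply: lF].
rewrite tsum_tens; last 2 first.
- by move=> z; apply: lin_tsumF => c1 c2; apply: (bF c1).1.
- by move=> z; lin.
rewrite lcm tsum_tsum; apply: eq_tsum => a1 a2.
rewrite tsum_tsum; apply: eq_tsum => b1 b2.
rewrite tsum_tens !hopf_mulE //; have := bFz (a3 * b3) => -[] //.
Qed.

(** With a = f(x_1) and b = g(S^-1(a_5) x_2 a_1), both sides expand to
m(m(a_3, b_2), h(S^-1(b_3) S^-1(a_4) x_3 a_2 b_1)), up to the associativity
of m. *)
Lemma star_assoc m f g h z : rcolinear B m -> lcolinear B m ->
  (forall a b c, m (a ⊗ m (b ⊗ c)) = m (m (a ⊗ b) ⊗ c)) ->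
  linear f -> linear g -> linear h ->
  star m f (star m g h) z = star m (star m f g) h z.
Proof.
move=> rcm lcm Am lf lg lh.
transitivity (\Δ_(z1, w <- z) \Δ_(z2, z3 <- w) \Δ_(x, y <- f z1)
  \Δ_(u, a3 <- x) \Δ_(a4, a5 <- y) \Δ_(a1, a2 <- u)
  m (a3 ⊗ \Δ_(v, b3 <- g (V a5 * z2 * a1)) \Δ_(b1, b2 <- v)
    m (b2 ⊗ h (V b3 * (V a4 * z3 * a2) * b1)))).
  apply: eq_tsum => z1 w; rewrite exchange_tsum; apply: eq_tsum => x y.
  rewrite exchange_tsum; apply: eq_tsum => u a3.
  rewrite /star (linear_tsum (f := fun u => m (a3 ⊗ u))); last by lin.
  rewrite comulM_tsum; last by lin.
  rewrite comulM_tsum; last by lin.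
  rewrite antipodeV_comul; last by lin.
  rewrite exchange_tsum; apply: eq_tsum => z2 z3.
  by apply: eq_tsum => a4 a5.
rewrite -coassoc; apply: eq_tsum => x z3; rewrite /star.
rewrite (linear_tsum (f := fun u => \Δ_(a', a3 <- u) \Δ_(a1, a2 <- a')
  m (a2 ⊗ h (V a3 * z3 * a1)))); last by lin.
apply: eq_tsum => z1 z2.
rewrite (coassoc5 _ (fun a1 a2 a3 a4 a5 =>
  m (a3 ⊗ \Δ_(v, b3 <- g (V a5 * z2 * a1)) \Δ_(b1, b2 <- v)
    m (b2 ⊗ h (V b3 * (V a4 * z3 * a2) * b1))))).
rewrite (linear_tsum (f := fun u => \Δ_(a', a3 <- u) \Δ_(a1, a2 <- a')
  m (a2 ⊗ h (V a3 * z3 * a1)))); last by lin.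
apply: eq_tsum => y a5.
rewrite (linear_tsum (f := fun u => \Δ_(a', a3 <- u) \Δ_(a1, a2 <- a')
  m (a2 ⊗ h (V a3 * z3 * a1)))); last by lin.
apply: eq_tsum => a1 a2.
rewrite (bicolinear_comul2 (F := fun c1 c2 c3 => m (c2 ⊗ h (V c3 * z3 * c1)))) //;
  [|by lin|by lin].
apply: eq_tsum => u a4; apply: eq_tsum => p a3.
rewrite (linear_tsum (f := fun u => m (a3 ⊗ u))); last by lin.
apply: eq_tsum => v b3.
rewrite (linear_tsum (f := fun u => m (a3 ⊗ u))); last by lin.
by apply: eq_tsum => b1 b2; rewrite Am antipodeVM !mulrA.
Qed.

(** On the right the argument of g contains d_1 S^-1(c_3), where c ⊗ d is the
coproduct of f(y_1 x_1); these adjacent legs cancel, which leaves the expansion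
of the left-hand side. *)
Lemma star_comul m n r f g x y :
  (forall a b, comul (r (a ⊗ b)) = \Δ_(a1, a2 <- a) \Δ_(b1, b2 <- b)
     m (a1 ⊗ b1) ⊗ n (a2 ⊗ b2)) ->
  linear f -> linear g ->
  comul (star r f g (y * x)) =
  \Δ_(x1, x2 <- x) \Δ_(y1, y2 <- y) \Δ_(c, d <- f (y1 * x1))
  \Δ_(u, c3 <- c) \Δ_(c1, c2 <- u) \Δ_(v, d3 <- d) \Δ_(d1, d2 <- v)
  \Δ_(b1, b2 <- g (V d3 * y2 * d1 * (V c3 * x2 * c1)))
    m (c2 ⊗ b1) ⊗ n (d2 ⊗ b2).
Proof.
move=> rE lf lg; rewrite /star linear_tsum; last by lin.
rewrite comulM_tsum; last by lin.
rewrite exchange_tsum; apply: eq_tsum => x1 x2; apply: eq_tsum => y1 y2.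
under [RHS]eq_tsum => c d.
  under eq_tsum => u c3.
    under eq_tsum => c1 c2.
      under eq_tsum => v d3.
        under eq_tsum => d1 d2.
          have -> : V d3 * y2 * d1 * (V c3 * x2 * c1) =
            V d3 * y2 * (d1 * V c3) * x2 * c1 by rewrite !mulrA.
          over.
        over.
      over.
    over.
  over.
rewrite (antipodeV_contract _ (F := fun c1 c2 z d2 d3 =>
  \Δ_(b1, b2 <- g (V d3 * y2 * z * x2 * c1)) m (c2 ⊗ b1) ⊗ n (d2 ⊗ b2)));
  last by lin.
rewrite linear_tsum; last by lin.
apply: eq_tsum => u a3; rewrite linear_tsum; last by lin.
by apply: eq_tsum => a1 a2; rewrite rE mulr1 mulrA.
Qed.

End Star.

(** * The double as maps from H to H *)

(** If each of two families of maps f_i, g_j has a linear reconstruction formula,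
then so has the family f_i ⊗ g_j on the tensor product; hence it separates
points. *)
Lemma tens_sep (k : fieldType) (U V U' V' : vectType k) (I J : finType)
    (f : I -> U -> U') (f' : I -> U' -> U) (g : J -> V -> V') (g' : J -> V' -> V)
    (T T' : tensor U V) :
  (forall i, linear (f' i)) -> (forall j, linear (g' j)) ->
  (forall u, \sum_i f' i (f i u) = u) -> (forall v, \sum_j g' j (g j v) = v) ->
  (forall i j, \tsum_(u, v <- T) f i u ⊗ g j v =
               \tsum_(u, v <- T') f i u ⊗ g j v) -> T = T'.
Proof.
move=> lf lg fK gK eT.
have rec t : t = \sum_i \sum_j
    \tsum_(x, y <- \tsum_(u, v <- t) f i u ⊗ g j v) f' i x ⊗ g' j y.
  transitivity (\tsum_(u, v <- t) \sum_i \sum_j f' i (f i u) ⊗ g' j (g j v)).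
    rewrite -[LHS]tsum_id; apply: eq_tsum => u v.
    transitivity (\sum_i f' i (f i u) ⊗ v).
      rewrite -{1}(fK u); apply: (linear_bigsum (f := fun x => x ⊗ v)); lin.
    apply: eq_bigr => i _; rewrite -{1}(gK v).
    by apply: (linear_bigsum (f := fun x => f' i (f i u) ⊗ x)); lin.
  rewrite tsum_sum; apply: eq_bigr => i _; rewrite tsum_sum.
  apply: eq_bigr => j _; rewrite tsum_tsum; apply: eq_tsum => u v.
  have := lf i; have := lg j => lgj lfi.
  by rewrite tsum_tens //; lin.
rewrite (rec T) (rec T'); apply: eq_bigr => i _; apply: eq_bigr => j _.
by rewrite eT.
Qed.

Section Evaluation.
Variables (k : fieldType) (H : hopfType k).
Local Notation ε := (@counit k H).
Local Notation D := (drinfeld_double H).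
Local Notation K := (dual H ⊗ H)%type.
Implicit Types (s t : tensor (dual H) H) (x y z : H).

(** The identification of H^* ⊗ H with End(H), p ⊗ h |-> (x |-> p(x) h). *)
Definition ev (t : tensor (dual H) H) x : H := \tsum_(p, h <- t) (p x : k) *: h.

Lemma ev_tens p h x : ev (p ⊗ h) x = (p x : k) *: h.
Proof. by rewrite /ev tsum_tens //; lin. Qed.

Lemma ev_lin x : linear (ev^~ x).
Proof. by rewrite /ev; lin. Qed.

Lemma ev_linr t : linear (ev t).
Proof. by rewrite /ev; lin. Qed.

Lemma dual_expand (p : dual H) : \sum_i (p (vbase i) : k) *: dual_base i = p.
Proof.
apply/lfunP => x; rewrite sum_lfunE -[RHS](dual_base_sum (f := p)); last by lin.
by apply: eq_bigr => i _; rewrite scale_lfunE; exact: mulrC.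
Qed.

Lemma ev_expand t : \sum_i dual_base i ⊗ ev t (vbase i) = t.
Proof.
rewrite -[RHS]tsum_id.
transitivity (\tsum_(p, h <- t) \sum_i (p (vbase i) : k) *: (dual_base i ⊗ h)).
  rewrite tsum_sum; apply: eq_bigr => i _; rewrite linear_tsum; last by lin.
  apply: eq_tsum => p h.
  by rewrite (linear_scale _ _ (f := fun u => dual_base i ⊗ u)); last by lin.
apply: eq_tsum => p h; rewrite -[in RHS](dual_expand p).
rewrite (linear_bigsum _ _ _ (f := fun u => u ⊗ h)); last by lin.
by apply: eq_bigr => i _; rewrite (linear_scale _ _ (f := fun u => u ⊗ h)); last by lin.
Qed.

Lemma ev_inj s t : (forall x, ev s x = ev t x) -> s = t.
Proof.
move=> est; rewrite -(ev_expand s) -(ev_expand t).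
by apply: eq_bigr => i _; rewrite est.
Qed.

Definition ev2 (T : tensor K K) x y := \tsum_(s, t <- T) ev s x ⊗ ev t y.

Lemma ev2_inj (T T' : tensor K K) :
  (forall x y, ev2 T x y = ev2 T' x y) -> T = T'.
Proof.
move=> eT.
apply: (tens_sep (f := fun i s => ev s (vbase i)) (f' := fun i h => dual_base i ⊗ h)
  (g := fun i s => ev s (vbase i)) (g' := fun i h => dual_base i ⊗ h)) => //;
  by [lin | exact: ev_expand | move=> i j; exact: eT].
Qed.

Lemma ev2_expand (T : tensor K K) : \sum_(ij : 'I_(dim H) * 'I_(dim H))
  \tsum_(x, y <- ev2 T (vbase ij.1) (vbase ij.2))
    (dual_base ij.1 ⊗ x) ⊗ (dual_base ij.2 ⊗ y) = T.
Proof.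
rewrite -[RHS]tsum_id.
transitivity (\tsum_(s, t <- T) \sum_i \sum_j
   (dual_base i ⊗ ev s (vbase i)) ⊗ (dual_base j ⊗ ev t (vbase j))).
  rewrite -(pair_bigA _ (fun i j => \tsum_(x, y <- ev2 T (vbase i) (vbase j))
    (dual_base i ⊗ x) ⊗ (dual_base j ⊗ y))) /=.
  rewrite tsum_sum; apply: eq_bigr => i _; rewrite tsum_sum.
  apply: eq_bigr => j _; rewrite tsum_tsum; apply: eq_tsum => s t.
  by rewrite tsum_tens //; lin.
apply: eq_tsum => s t; rewrite -[in RHS](ev_expand s).
rewrite (linear_bigsum _ _ _ (f := fun u => u ⊗ t)); last by lin.
apply: eq_bigr => i _; rewrite -[in RHS](ev_expand t).
rewrite (linear_bigsum _ _ _ (f := fun u => (dual_base i ⊗ _) ⊗ u)) //.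
by lin.
Qed.

Lemma ev3_inj (T T' : tensor K (tensor K K)) :
  (forall x y z, \tsum_(s, t <- T) ev s x ⊗ ev2 t y z =
                 \tsum_(s, t <- T') ev s x ⊗ ev2 t y z) -> T = T'.
Proof.
move=> eT.
apply: (tens_sep (f := fun i s => ev s (vbase i)) (f' := fun i h => dual_base i ⊗ h)
  (g := fun ij T => ev2 T (vbase ij.1) (vbase ij.2))
  (g' := fun ij w => \tsum_(x, y <- w)
     (dual_base ij.1 ⊗ x) ⊗ (dual_base ij.2 ⊗ y))) => //.
- by lin.
- by lin.
- exact: ev_expand.
- exact: ev2_expand.
Qed.

(** Under [ev], the coproduct of D(H) sends f to (x, y) |-> Δ(f(y x)): the factor
H^* carries the opposite coproduct, whence the order y x. *)
Lemma ev_comul (W : vectType k) (F : H -> H -> W) s x y : bilin F ->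
  \tsum_(s1, s2 <- bcomul D s) F (ev s1 x) (ev s2 y) =
  \Δ_(a, b <- ev s (y * x)) F a b.
Proof.
move=> bF; rewrite tliftE tsum_tsum {3}/ev.
rewrite (linear_tsum (f := fun a => \Δ_(a, b <- a) F a b)); last by lin.
apply: eq_tsum => p h; rewrite tsum_tsum.
rewrite (linear_scale _ _ (f := fun a => \Δ_(a, b <- a) F a b)); last by lin.
rewrite -dual_comulE.
rewrite (linear_tsum (f := fun c : k^o => (c : k) *: \Δ_(a, b <- h) F a b));
  last by lin.
apply: eq_tsum => p1 p2; rewrite tsum_tsum scale_tsum; apply: eq_tsum => h1 h2.
rewrite tsum_tens; last 2 first.
- by move=> u; rewrite /ev; lin.
- by move=> u; rewrite /ev; lin.
rewrite !ev_tens (linear_scale _ _ (bF.1 _)).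
rewrite (linear_scale _ _ (f := fun u => F u _)); last by lin.
by rewrite scalerA.
Qed.

Lemma double_counitE s : bcounit D s = ε (ev s 1).
Proof.
rewrite tliftE /ev linear_tsum; last by lin.
by apply: eq_tsum => p h; rewrite linearZ.
Qed.

Lemma ev_double_one x : ev (bone D) x = (ε x : k) *: 1.
Proof. exact: ev_tens. Qed.

End Evaluation.

(** * The crossed product on the double *)

Section Crossed.
Variables (k : fieldType) (H : hopfType k).
Local Notation V := (@antipodeV k H).
Local Notation ε := (@counit k H).
Local Notation B := (hopf_bialg H).
Local Notation D := (drinfeld_double H).
Local Notation K := (dual H ⊗ H)%type.
Implicit Types (s t : tensor (dual H) H) (x y z : H) (m n r : 'Hom((H ⊗ H)%type, H)).

Definition hopf_bicomod m : bicomod_alg H H := {|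
  amul := m; aone := 1; rcoact := comul; lcoact := comul |}.

Definition crossed m := diag_crossed_mul (hopf_bicomod m).

Lemma ev_crossed m s t z : ev (crossed m (s ⊗ t)) z = star m (ev s) (ev t) z.
Proof.
rewrite tlift_tens; last by lin.
rewrite {1}/ev tsum_tsum.
transitivity (\tsum_(p, a <- s) \Δ_(z1, z2 <- z) (p z1 : k) *:
   \Δ_(a', a3 <- a) \Δ_(a1, a2 <- a') m (a2 ⊗ ev t (V a3 * z2 * a1))).
  apply: eq_tsum => p a; rewrite tsum_tsum.
  transitivity (\tsum_(q, b <- t) \Δ_(z1, z2 <- z) \Δ_(a', a3 <- a)
     \Δ_(a1, a2 <- a') ((p z1 : k) * q (V a3 * z2 * a1) : k) *: m (a2 ⊗ b)).
    apply: eq_tsum => q b; rewrite tsum_tsum exchange_tsum; apply: eq_tsum => a' a3.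
    rewrite tsum_tsum exchange_tsum; apply: eq_tsum => a1 a2.
    rewrite -/(ev _ z) ev_tens dual_mulE.
    rewrite (linear_tsum (f := fun c : k^o => (c : k) *: m (a2 ⊗ b))); last by lin.
    by apply: eq_tsum => z1 z2; rewrite dual_ractE dual_lactE.
  rewrite exchange_tsum; apply: eq_tsum => z1 z2.
  rewrite exchange_tsum scale_tsum; apply: eq_tsum => a' a3.
  rewrite exchange_tsum scale_tsum; apply: eq_tsum => a1 a2.
  rewrite {1}/ev (linear_tsum (f := fun u => m (a2 ⊗ u))); last by lin.
  rewrite scale_tsum; apply: eq_tsum => q b.
  by rewrite (linear_scale _ _ (f := fun u => m (a2 ⊗ u))) ?scalerA; last by lin.
rewrite exchange_tsum; apply: eq_tsum => z1 z2.
have lt := ev_linr t.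
rewrite {2}/ev (linear_tsum (f := fun a => \Δ_(a', a3 <- a) \Δ_(a1, a2 <- a')
  m (a2 ⊗ ev t (V a3 * z2 * a1)))); last by lin.
apply: eq_tsum => p a.
by rewrite (linear_scale _ _ (f := fun a => \Δ_(a', a3 <- a) \Δ_(a1, a2 <- a')
  m (a2 ⊗ ev t (V a3 * z2 * a1)))); last by lin.
Qed.

Lemma double_mulE : bmul D = crossed (bmul B).
Proof.
apply: hom_tens_ext => s t; rewrite !tlift_tens; [|by lin|by lin].
apply: eq_tsum => p a; apply: eq_tsum => q b; apply: eq_tsum => a' a3.
by apply: eq_tsum => a1 a2; rewrite hopf_mulE.
Qed.

(** The formula of [star_comul], read on elements of H^* ⊗ H; F collects the part
that depends on s only through its coproduct. *)
Lemma crossed_comul m n r :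
  (forall a b, comul (r (a ⊗ b)) = \Δ_(a1, a2 <- a) \Δ_(b1, b2 <- b)
     m (a1 ⊗ b1) ⊗ n (a2 ⊗ b2)) ->
  forall s t, bcomul D (crossed r (s ⊗ t)) =
    \tsum_(s1, s2 <- bcomul D s) \tsum_(t1, t2 <- bcomul D t)
      crossed m (s1 ⊗ t1) ⊗ crossed n (s2 ⊗ t2).
Proof.
move=> rE s t; have ls := ev_linr s; have lt := ev_linr t.
have evl x : linear (fun t => ev t x) := @ev_lin k H x.
have evr u : linear (ev u) := @ev_linr k H u.
apply: ev2_inj => x y.
rewrite /ev2 (ev_comul _ _ _ (F := fun a b => a ⊗ b)); last by lin.
rewrite tsum_id ev_crossed (star_comul _ _ rE ls lt).
rewrite tsum_tsum.
transitivity (\tsum_(s1, s2 <- bcomul D s) \tsum_(t1, t2 <- bcomul D t)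
   star m (ev s1) (ev t1) x ⊗ star n (ev s2) (ev t2) y); last first.
  apply: eq_tsum => s1 s2; rewrite tsum_tsum; apply: eq_tsum => t1 t2.
  rewrite tsum_tens ?ev_crossed // => u.
    by apply: lin_tensr; apply: evl.
  by apply: lin_tens; apply: evl.
pose F x2 y2 c d := \Δ_(u, c3 <- c) \Δ_(c1, c2 <- u)
  \Δ_(v, d3 <- d) \Δ_(d1, d2 <- v) \tsum_(t1, t2 <- bcomul D t)
  m (c2 ⊗ ev t1 (V c3 * x2 * c1)) ⊗ n (d2 ⊗ ev t2 (V d3 * y2 * d1)).
have bF x2 y2 : bilin (F x2 y2).
  split=> u; rewrite /F; first by lin.
  by lin.
transitivity (\Δ_(x1, x2 <- x) \Δ_(y1, y2 <- y) \tsum_(s1, s2 <- bcomul D s)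
    F x2 y2 (ev s1 x1) (ev s2 y1)).
  apply: eq_tsum => x1 x2; apply: eq_tsum => y1 y2.
  rewrite ev_comul //; apply: eq_tsum => c d.
  apply: eq_tsum => u c3; apply: eq_tsum => c1 c2.
  apply: eq_tsum => v d3; apply: eq_tsum => d1 d2.
  by rewrite (ev_comul _ _ _ (F := fun a b => m (c2 ⊗ a) ⊗ n (d2 ⊗ b))) //; lin.
transitivity (\tsum_(s1, s2 <- bcomul D s) \Δ_(x1, x2 <- x) \Δ_(y1, y2 <- y)
    F x2 y2 (ev s1 x1) (ev s2 y1)).
  rewrite [RHS]exchange_tsum; apply: eq_tsum => x1 x2.
  by rewrite [RHS]exchange_tsum.
apply: eq_tsum => s1 s2.
transitivity (\tsum_(t1, t2 <- bcomul D t) \Δ_(x1, x2 <- x)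
  \Δ_(u, c3 <- ev s1 x1) \Δ_(c1, c2 <- u) \Δ_(y1, y2 <- y)
  \Δ_(v, d3 <- ev s2 y1) \Δ_(d1, d2 <- v)
  m (c2 ⊗ ev t1 (V c3 * x2 * c1)) ⊗ n (d2 ⊗ ev t2 (V d3 * y2 * d1))).
  rewrite [RHS]exchange_tsum; apply: eq_tsum => x1 x2; rewrite /F.
  rewrite exchange_tsum [RHS]exchange_tsum; apply: eq_tsum => u c3.
  rewrite exchange_tsum [RHS]exchange_tsum; apply: eq_tsum => c1 c2.
  rewrite [RHS]exchange_tsum; apply: eq_tsum => y1 y2.
  rewrite [RHS]exchange_tsum; apply: eq_tsum => v d3.
  by rewrite [RHS]exchange_tsum.
apply: eq_tsum => t1 t2; set w := star n _ _ _.
rewrite /star (linear_tsum (f := fun z => z ⊗ w)); last by lin.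
apply: eq_tsum => x1 x2; rewrite (linear_tsum (f := fun z => z ⊗ w)); last by lin.
apply: eq_tsum => u c3; rewrite (linear_tsum (f := fun z => z ⊗ w)); last by lin.
apply: eq_tsum => c1 c2; set z := m _.
rewrite /w /star (linear_tsum (f := fun w => z ⊗ w)); last by lin.
apply: eq_tsum => y1 y2; rewrite (linear_tsum (f := fun w => z ⊗ w)); last by lin.
apply: eq_tsum => v d3.
by rewrite (linear_tsum (f := fun w => z ⊗ w)); last by lin.
Qed.

Lemma eq_star m (f f' g g' : H -> H) z : f =1 f' -> g =1 g' ->
  star m f g z = star m f' g' z.
Proof.
move=> ef eg; apply: eq_tsum => z1 z2; rewrite ef; apply: eq_tsum => a' a3.
by apply: eq_tsum => a1 a2; rewrite eg.
Qed.

Lemma crossed_algebra m : rcolinear B m -> lcolinear B m ->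
  is_algebra m (1 : H) -> is_algebra (crossed m) (bone D).
Proof.
move=> rcm lcm [Am m1l m1r]; split=> [s t u | s | s]; apply: ev_inj => z.
- have [[ls lt] lu] := (@ev_linr k H s, @ev_linr k H t, @ev_linr k H u).
  transitivity (star m (ev s) (star m (ev t) (ev u)) z).
    by rewrite ev_crossed; apply: eq_star => // y; exact: ev_crossed.
  rewrite star_assoc // [RHS]ev_crossed.
  by apply: eq_star => // y; rewrite ev_crossed.
- have ls := @ev_linr k H s.
  rewrite ev_crossed /star -(counitl_tsum (f := ev s)) //.
  apply: eq_tsum => z1 z2; rewrite ev_double_one.
  rewrite (linear_scale _ _ (f := fun a => \Δ_(a', a3 <- a) \Δ_(a1, a2 <- a')
     m (a2 ⊗ ev s (V a3 * z2 * a1)))); last by lin.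
  rewrite comul1_tsum; last by lin.
  rewrite comul1_tsum; last by lin.
  by rewrite antipodeV1 m1l mul1r mulr1.
- have ls := @ev_linr k H s.
  rewrite ev_crossed /star -(counitr_tsum (f := ev s)) //.
  apply: eq_tsum => z1 z2;
  rewrite -[in RHS](counitr_tsum (f := id) (ev s z1)); last by lin.
  rewrite scale_tsum; apply: eq_tsum => a' a3.
  rewrite -[in RHS](counitl_tsum (f := id) a'); last by lin.
  rewrite !scale_tsum; apply: eq_tsum => a1 a2.
  rewrite ev_double_one !counitM counit_antipodeV.
  rewrite (linear_scale _ _ (f := fun u => m (a2 ⊗ u))); last by lin.
  by rewrite m1r !scalerA [_ * ε z2]mulrC.
Qed.

Lemma counit_star m (G : H -> H -> k^o) (f g : H -> H) :
  (forall a b, ε (m (a ⊗ b)) = G a b) -> linear f -> linear g ->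
  ε (star m f g 1) = \Δ_(a', a3 <- f 1) \Δ_(a1, a2 <- a') G a2 (g (V a3 * a1)).
Proof.
move=> GE lf lg; rewrite /star comul1_tsum; last by lin.
rewrite linear_tsum; last by lin.
apply: eq_tsum => a' a3; rewrite linear_tsum; last by lin.
by apply: eq_tsum => a1 a2; rewrite GE mulr1.
Qed.

Lemma counit_conjugate (g : H -> H) a : linear g ->
  \Δ_(a1, a3 <- a) ε (g (V a3 * a1)) = ε a * ε (g 1) :> k^o.
Proof.
by move=> lg; rewrite (antipodeVl_tsum (f := fun z => ε (g z))) //; lin.
Qed.

(** The multiplicativity of the counit of D(H), as a formula on H. *)
Lemma counit_star_collapse (g : H -> H) a : linear g ->
  \Δ_(a', a3 <- a) \Δ_(a1, a2 <- a') (ε a2 * ε (g (V a3 * a1)) : k^o) =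
  ε a * ε (g 1).
Proof.
move=> lg; rewrite -counit_conjugate //; apply: eq_tsum => a' a3.
by rewrite (counitr_tsum (f := fun a1 => ε (g (V a3 * a1)))) //; lin.
Qed.

End Crossed.

(** * The cocycle on the double *)

Section DoubleCocycle.
Variables (k : fieldType) (H : hopfType k).
Local Notation V := (@antipodeV k H).
Local Notation ε := (@counit k H).
Local Notation B := (hopf_bialg H).
Local Notation D := (drinfeld_double H).
Local Notation K := (dual H ⊗ H)%type.
Implicit Types (s t : tensor (dual H) H) (x y z : H) (σ : 'Hom((H ⊗ H)%type, k^o)).

Lemma double_augmented : augmented D.
Proof.
have evl x : linear (fun t => ev t x) := @ev_lin k H x.
have evr u : linear (ev u) := @ev_linr k H u.
split.
- move=> s; apply: ev3_inj => x y z.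
  transitivity (\tsum_(r, c <- bcomul D s) \tsum_(a, b <- bcomul D r)
      ev a x ⊗ (ev b y ⊗ ev c z)).
    rewrite tsum_tsum; apply: eq_tsum => r c; rewrite tsum_tsum.
    apply: eq_tsum => a b; rewrite tsum_tens; last 2 first.
    + by move=> u; rewrite /ev2; lin.
    + by move=> u; apply: lin_tens; apply: evl.
    rewrite /ev2 tsum_tens // => u; [apply: lin_tensr | apply: lin_tens]; exact: evl.
  transitivity (\tsum_(a, r <- bcomul D s) \tsum_(b, c <- bcomul D r)
      ev a x ⊗ (ev b y ⊗ ev c z)); last first.
    rewrite tsum_tsum; apply: eq_tsum => a r; rewrite tsum_tsum.
    apply: eq_tsum => b c; rewrite tsum_tens; last 2 first.
    + by move=> u; rewrite /ev2; lin.
    + by move=> u; apply: lin_tens; apply: evl.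
    rewrite /ev2 tsum_tens // => u; [apply: lin_tensr | apply: lin_tens]; exact: evl.
  transitivity (\Δ_(u, w <- ev s (z * (y * x))) \Δ_(a, b <- u) a ⊗ (b ⊗ w)).
    rewrite -(ev_comul _ _ _ (F := fun u w => \Δ_(a, b <- u) a ⊗ (b ⊗ w)));
      last by lin.
    apply: eq_tsum => r c.
    by rewrite (ev_comul _ _ _ (F := fun a b => a ⊗ (b ⊗ ev c z))); last by lin.
  rewrite coassoc mulrA.
  rewrite -(ev_comul _ _ _ (F := fun a w => \Δ_(b, c <- w) a ⊗ (b ⊗ c)));
    last by lin.
  apply: eq_tsum => a r.
  by rewrite (ev_comul _ _ _ (F := fun b c => ev a x ⊗ (b ⊗ c))); last by lin.
- move=> s; apply: ev_inj => x.
  rewrite (linear_tsum (f := fun t => ev t x)) // -[in RHS](mulr1 x).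
  rewrite -(counitl_tsum (f := id) (ev s _)); last by lin.
  rewrite -(ev_comul _ _ _ (F := fun a b => (ε a : k) *: b)); last by lin.
  apply: eq_tsum => s1 s2; rewrite (linear_scale _ _ (f := fun t => ev t x)) //.
  by rewrite double_counitE.
- move=> s; apply: ev_inj => x.
  rewrite (linear_tsum (f := fun t => ev t x)) // -[in RHS](mul1r x).
  rewrite -(counitr_tsum (f := id) (ev s _)); last by lin.
  rewrite -(ev_comul _ _ _ (F := fun a b => (ε b : k) *: a)); last by lin.
  apply: eq_tsum => s1 s2; rewrite (linear_scale _ _ (f := fun t => ev t x)) //.
  by rewrite double_counitE.
- apply: ev2_inj => x y; rewrite /ev2 tsum_tens; last 2 first.
  + by move=> u; apply: lin_tensr; apply: evl.
  + by move=> u; apply: lin_tens; apply: evl.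
  rewrite (ev_comul _ _ _ (F := fun a b => a ⊗ b)); last by lin.
  rewrite tsum_id !ev_double_one linearZ /= comul1.
  rewrite (linear_scale _ _ (f := fun u => u ⊗ (_ : H))); last by lin.
  rewrite (linear_scale _ _ (f := fun u => (1 : H) ⊗ u)); last by lin.
  by rewrite scalerA counitM mulrC.
- move=> s t; rewrite double_mulE !double_counitE ev_crossed.
  rewrite (counit_star (G := fun a b => ε a * ε b)) //; last first.
    by move=> a b; rewrite hopf_mulE counitM.
  exact: counit_star_collapse.
Qed.

Lemma double_cocycleE σ s t : double_cocycle σ (s ⊗ t) =
  \Δ_(a', a3 <- ev s 1) \Δ_(a1, a2 <- a') σ (a2 ⊗ ev t (V a3 * a1)).
Proof.
have evr u : linear (ev u) := @ev_linr k H u.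
rewrite tlift_tens; last by lin.
rewrite {1}/ev (linear_tsum (f := fun a => \Δ_(a', a3 <- a) \Δ_(a1, a2 <- a')
  σ (a2 ⊗ ev t (V a3 * a1)))); last by lin.
apply: eq_tsum => p a; rewrite (linear_scale _ _ (f := fun a => \Δ_(a', a3 <- a)
  \Δ_(a1, a2 <- a') σ (a2 ⊗ ev t (V a3 * a1)))); last by lin.
rewrite exchange_tsum scale_tsum; apply: eq_tsum => a' a3.
rewrite exchange_tsum scale_tsum; apply: eq_tsum => a1 a2.
rewrite /ev (linear_tsum (f := fun u => σ (a2 ⊗ u))); last by lin.
rewrite scale_tsum; apply: eq_tsum => q b.
rewrite (linear_scale _ _ (f := fun u => σ (a2 ⊗ u))); last by lin.
by rewrite scalerA.
Qed.

(** In the product of the two cocycles the inner factors S^-1(h_3) and h_4 cancel,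
so that the convolution of σ and σ' appears on the middle legs. *)
Lemma conv_double σ σ' : (forall a b, conv B σ σ' a b = ε a * ε b) ->
  forall s t, conv D (double_cocycle σ) (double_cocycle σ') s t =
    bcounit D s * bcounit D t.
Proof.
move=> sE s t; have evr u : linear (ev u) := @ev_linr k H u.
rewrite !double_counitE -counit_star_collapse //.
pose F c d := \Δ_(u, c3 <- c) \Δ_(c1, c2 <- u) \Δ_(v, d3 <- d) \Δ_(d1, d2 <- v)
  \tsum_(t1, t2 <- bcomul D t)
  (σ (c2 ⊗ ev t1 (V c3 * c1)) * σ' (d2 ⊗ ev t2 (V d3 * d1)) : k^o).
have bF : bilin F by split=> u; rewrite /F; lin.
transitivity (\tsum_(s1, s2 <- bcomul D s) F (ev s1 1) (ev s2 1)).
  apply: eq_tsum => s1 s2; rewrite /F.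
  transitivity (\tsum_(t1, t2 <- bcomul D t)
    \Δ_(u, c3 <- ev s1 1) \Δ_(c1, c2 <- u) \Δ_(v, d3 <- ev s2 1) \Δ_(d1, d2 <- v)
    (σ (c2 ⊗ ev t1 (V c3 * c1)) * σ' (d2 ⊗ ev t2 (V d3 * d1)) : k^o)).
    apply: eq_tsum => t1 t2; rewrite !double_cocycleE.
    rewrite (linear_tsum (f := fun c : k^o => (c * _ : k^o))); last by lin.
    apply: eq_tsum => u c3.
    rewrite (linear_tsum (f := fun c : k^o => (c * _ : k^o))); last by lin.
    apply: eq_tsum => c1 c2.
    rewrite (linear_tsum (f := fun c : k^o => (_ * c : k^o))); last by lin.
    apply: eq_tsum => v d3.
    by rewrite (linear_tsum (f := fun c : k^o => (_ * c : k^o))); last by lin.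
  rewrite exchange_tsum; apply: eq_tsum => u c3.
  rewrite exchange_tsum; apply: eq_tsum => c1 c2.
  rewrite exchange_tsum; apply: eq_tsum => v d3.
  by rewrite exchange_tsum.
rewrite ev_comul // mulr1.
transitivity (\Δ_(c, d <- ev s 1) \Δ_(u, c3 <- c) \Δ_(c1, c2 <- u)
  \Δ_(v, d3 <- d) \Δ_(d1, d2 <- v) \Δ_(b1, b2 <- ev t (V d3 * (d1 * V c3) * c1))
    (σ (c2 ⊗ b1) * σ' (d2 ⊗ b2) : k^o)).
  apply: eq_tsum => c d.
  apply: eq_tsum => u c3; apply: eq_tsum => c1 c2.
  apply: eq_tsum => v d3; apply: eq_tsum => d1 d2.
  rewrite (ev_comul _ _ _ (F := fun a b => σ (c2 ⊗ a) * σ' (d2 ⊗ b))); last by lin.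
  by rewrite !mulrA.
rewrite (antipodeV_contract _ (F := fun c1 c2 z d2 d3 => \Δ_(b1, b2 <- ev t (V d3 * z * c1))
    (σ (c2 ⊗ b1) * σ' (d2 ⊗ b2) : k^o))); last by lin.
apply: eq_tsum => x a3; apply: eq_tsum => a1 y.
by rewrite mulr1; apply: sE.
Qed.

Variable σ : 'Hom((H ⊗ H)%type, k^o).
Hypothesis lazy_σ : lazy_2cocycle B σ.
Local Notation m := (amul (cocycle_twist B σ)).

Lemma double_cocycle_counit s t :
  double_cocycle σ (s ⊗ t) = bcounit D (crossed m (s ⊗ t)).
Proof.
have evr u : linear (ev u) := @ev_linr k H u.
rewrite double_counitE ev_crossed double_cocycleE.
rewrite (counit_star (G := fun a b => σ (a ⊗ b))) // => a b.
by rewrite -(counit_twist (hopf_augmented H)).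
Qed.

Lemma crossed_rcolinear : rcolinear D (crossed m).
Proof.
move=> s t; rewrite double_mulE; apply: crossed_comul.
exact: twist_rcolinear.
Qed.

Lemma crossed_lcolinear : lcolinear D (crossed m).
Proof.
move=> s t; rewrite double_mulE; apply: crossed_comul.
exact: twist_lcolinear.
Qed.

Lemma crossed_twist_algebra : is_algebra (crossed m) (bone D).
Proof.
apply: crossed_algebra; [exact: twist_rcolinear | exact: twist_lcolinear |].
exact: twist_algebra.
Qed.

End DoubleCocycle.

Theorem proposition3p1 (k : fieldType) (H : hopfType k)
    (σ : 'Hom((H ⊗ H)%type, k^o))
    (hσ : lazy_2cocycle (hopf_bialg H) σ) :
  let D := drinfeld_double H in
  let HσX := diag_crossed (cocycle_twist (hopf_bialg H) σ) in
  [/\ lazy_2cocycle D (double_cocycle σ),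
      is_bicomod_alg D HσX,
      HσX = cocycle_twist D (double_cocycle σ) &
      forall τ : 'Hom(((dual H ⊗ H) ⊗ (dual H ⊗ H))%type, k^o),
        lazy_2cocycle D τ -> HσX = cocycle_twist D τ ->
        τ = double_cocycle σ].
Proof.
move=> D X.
have augD := double_augmented H.
have algX := crossed_twist_algebra hσ.
have rX := crossed_rcolinear σ; have lX := crossed_lcolinear hσ.
have sE := double_cocycle_counit σ.
have XE : X = cocycle_twist D (double_cocycle σ).
  have mE := bicolinear_mul augD rX sE.
  by rewrite /cocycle_twist -[tlift _]/(amul (cocycle_twist D _)) mE.
split; [| | exact: XE |].
- split; [exact (bicolinear_cocycle augD algX rX sE)
    | exact (bicolinear_normalized algX sE) | | exact (bicolinear_lazy augD rX lX sE)].
  case: hσ => _ _ [σ' sK] _; exists (double_cocycle σ') => s t.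
  by split; apply: conv_double => a b; case: (sK a b).
- by rewrite XE; apply: (bicolinear_bicomod_alg augD algX rX lX sE).
- move=> τ _ XtE; apply: hom_tens_ext => s t.
  by rewrite -(counit_twist augD τ) -XtE sE.
Qed.
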